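(* Let $n\ge 0$ be an integer and let $X$ be a tropical variety in $\mathbb R^n$. Then the congruence $\mathbf E(|X|)$ on $\mathbb T[x_1^{\pm},\ldots,x_n^{\pm}]_{\mathrm{fcn}}$ is finitely generated if and only if $|X|$ is a rational affine linear subspace of $\mathbb R^n$.
   Context: Tropical algebra. The tropical semifield is $\mathbb T=\mathbb R\cup\{-\infty\}$ with addition $a\oplus b=\max\{a,b\}$ and multiplication $a\odot b=a+b$ (additive identity $-\infty$, multiplicative identity $0$). A tropical Laurent polynomial $P=\bigoplus_{\bm u\in\mathbb Z^n}a_{\bm u}\bm x^{\bm u}$ ($a_{\bm u}\in\mathbb T$, all but finitely many equal to $-\infty$) defines the function $\overline P:\mathbb R^n\to\mathbb T$, $\overline P(\bm p)=\max_{\bm u}(a_{\bm u}+\bm u\cdot\bm p)$. $\mathbb T[x_1^{\pm},\ldots,x_n^{\pm}]_{\mathrm{fcn}}$ is the semiring of all such functions under pointwise $\oplus,\odot$. A congruence on a commutative semiring $R$ is an equivalence relation $E\subset R\times R$ closed under coordinatewise addition and multiplication; it is finitely generated if it is the smallest congruence containing some finite subset of $R\times R$. For $Z\subset\mathbb R^n$, $\mathbf E(Z)=\{(f,g) : f,g\in\mathbb T[x_1^{\pm},\ldots,x_n^{\pm}]_{\mathrm{fcn}},\ f|_Z=g|_Z\}$, a congruence. Polyhedral conventions. A rational affine linear function on $\mathbb R^n$ is $a_1x_1+\cdots+a_nx_n+b$ with $a_i\in\mathbb Z$ not all $0$ and $b\in\mathbb R$. A rational polyhedron is a nonempty set of the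 form $\{\bm p : f_1(\bm p)\ge0,\ldots,f_m(\bm p)\ge 0\}$ with $f_i$ rational affine linear functions ($m\ge 0$). A face of a polyhedron $\sigma$ is $\sigma$ itself or a nonempty set $\sigma\cap\{f=0\}$ where $f$ is an affine linear function (real coefficients) with $f\ge0$ on $\sigma$. $\mathrm{Aff}(\sigma)$ is the affine span of $\sigma$, $\dim\sigma=\dim\mathrm{Aff}(\sigma)$, $L(\sigma)$ is the linear subspace parallel to $\mathrm{Aff}(\sigma)$, and $\Lambda(\sigma)=L(\sigma)\cap\mathbb Z^n$. A rational polyhedral complex $X$ is a nonempty finite collection of rational polyhedra, closed under taking faces, such that any two members with nonempty intersection meet in a common face; all complexes are assumed connected, i.e. any two members are joined by a finite sequence of members in which of any two consecutive ones, one is a face of the other. Its support $|X|$ is the union of its members. Facets are the inclusion-maximal members; $X$ is pure $d$-dimensional if all facets have dimension $d$. A $d$-dimensional tropical variety in $\mathbb R^n$ is a pure $d$-dimensional rational polyhedral complex $X$ with a weight function $\omega_X$ from its facets to $\mathbb Z_{>0}$ that is balanced: for each $(d-1)$-dimensional $\tau\in X$, $\sum_{\sigma}\omega_X(\sigma)\bm u_{\sigma/\tau}\in\Lambda(\tau)$, the sum over facets $\sigma$ having $\tau$ as a face, where $\bm u_{\sigma/\tau}\in\mathbb Z^n$ is any vector with $\sigma\subset\mathrm{Aff}(\tau)+\mathbb R_{\ge0}\bm u_{\sigma/\tau}$ and $\Lambda(\sigma)=\Lambda(\tau)+\mathbb Z\bm u_{\sigma/\tau}$. A rational affine linear subspace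 of $\mathbb R^n$ is a set $\bm p+\mathbb R\bm q_1+\cdots+\mathbb R\bm q_d$ with $\bm p\in\mathbb R^n$ and $\bm q_1,\ldots,\bm q_d\in\mathbb Z^n$. *)

(* Defs.v *)
From HB Require Import structures.
From mathcomp Require Import all_boot all_order all_algebra.
From mathcomp Require Import finmap.
From mathcomp Require Import all_classical all_reals.

Set Implicit Arguments.
Unset Strict Implicit.
Unset Printing Implicit Defensive.

Import Order.TTheory GRing.Theory Num.Theory.

Local Open Scope classical_set_scope.
Local Open Scope ring_scope.

(* The ring notations [0], [1], [+], [*] on [trop R] denote the tropical *)
(* operations: -oo, the real number 0, the maximum and the usual sum. *)
Variant trop (R : realType) : Type := NegInf | Fin of R.
Arguments NegInf {R}.

Section TropSemiring.
Variable R : realType.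
Implicit Types x y z : trop R.

Definition option_of_trop x : option R := if x is Fin a then Some a else None.
Definition trop_of_option (o : option R) : trop R :=
  if o is Some a then Fin a else NegInf.
Lemma option_of_tropK : cancel option_of_trop trop_of_option.
Proof. by case. Qed.
HB.instance Definition _ := Choice.copy (trop R) (can_type option_of_tropK).

Definition trop_add x y : trop R :=
  match x, y with
  | NegInf, _ => y
  | _, NegInf => x
  | Fin a, Fin b => Fin (Num.max a b)
  end.

Definition trop_mul x y : trop R :=
  match x, y with
  | Fin a, Fin b => Fin (a + b)
  | _, _ => NegInf
  end.

Lemma trop_addA : associative trop_add.
Proof. by move=> [|a] [|b] [|c] //=; rewrite maxA. Qed.
Lemma trop_addC : commutative trop_add.
Proof. by move=> [|a] [|b] //=; rewrite maxC. Qed.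
Lemma trop_add0 : left_id NegInf trop_add.
Proof. by []. Qed.
HB.instance Definition _ :=
  GRing.isNmodule.Build (trop R) trop_addA trop_addC trop_add0.

Lemma trop_mulA : associative trop_mul.
Proof. by move=> [|a] [|b] [|c] //=; rewrite addrA. Qed.
Lemma trop_mulC : commutative trop_mul.
Proof. by move=> [|a] [|b] //=; rewrite addrC. Qed.
Lemma trop_mul1 : left_id (Fin 0) trop_mul.
Proof. by move=> [|a] //=; rewrite add0r. Qed.
Lemma trop_mulDl : left_distributive trop_mul trop_add.
Proof. by move=> [|a] [|b] [|c] //=; rewrite addr_maxl. Qed.
Lemma trop_mul0 : left_zero NegInf trop_mul.
Proof. by []. Qed.
HB.instance Definition _ := GRing.Nmodule_isComPzSemiRing.Build (trop R)
  trop_mulA trop_mulC trop_mul1 trop_mulDl trop_mul0.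

End TropSemiring.

Section LaurentFunctions.
Variables (R : realType) (n : nat).

Definition zdot (u : 'rV[int]_n) (p : 'rV[R]_n) : R :=
  \sum_(i < n) (u 0 i)%:~R * p 0 i.

Lemma zdotD u v p : zdot (u + v) p = zdot u p + zdot v p.
Proof.
rewrite /zdot -big_split /=; apply: eq_bigr => i _.
by rewrite mxE rmorphD mulrDl.
Qed.

Lemma zdot0 p : zdot 0 p = 0.
Proof. by rewrite /zdot big1 // => i _; rewrite mxE mul0r. Qed.

Definition trop_laurent : Type :=
  {fsfun 'rV[int]_n -> trop R with (0 : trop R)}.

(* A tropical sum, i.e. max_u (a_u + u . p), and -oo when no a_u is finite. *)
Definition trop_eval (P : trop_laurent) (p : 'rV[R]_n) : trop R :=
  \sum_(u <- finsupp P) P u * Fin (zdot u p).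

Definition is_laurent_fun (f : 'rV[R]_n -> trop R) : Prop :=
  exists P : trop_laurent, f = trop_eval P.

Lemma is_laurent_fun_seq (s : seq ('rV[int]_n * trop R)) :
  is_laurent_fun (fun p => \sum_(m <- s) m.2 * Fin (zdot m.1 p)).
Proof.
pose S := seq_fset tt [seq m.1 | m <- s].
pose P : trop_laurent :=
  [fsfun u in S => \sum_(m <- s | m.1 == u) m.2 | (0 : trop R)].
exists P; apply/funext => p; rewrite /trop_eval.
have PE u : P u = \sum_(m <- s | m.1 == u) m.2.
  rewrite fsfunE; case: ifPn => // uS; rewrite big_seq_cond big1 //.
  move=> m /andP[ms /eqP mu]; case/negP: uS.
  by rewrite seq_fsetE -mu; apply/mapP; exists m.
have -> : \sum_(u <- finsupp P) P u * Fin (zdot u p)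
        = \sum_(u <- S) P u * Fin (zdot u p).
  have sPS : (finsupp P `<=` S)%fset by exact: finsupp_sub.
  apply: big_fset_incl => // u uS; rewrite mem_finsupp negbK => /eqP ->.
  by rewrite mul0r.
under [RHS]eq_bigr do rewrite PE mulr_suml.
rewrite (exchange_big_dep xpredT) //= big_seq [RHS]big_seq.
apply: eq_bigr => m ms; rewrite -big_filter.
have -> : [seq u <- S | m.1 == u] = [:: m.1].
  under eq_filter do rewrite eq_sym.
  rewrite filter_pred1_uniq ?fset_uniq // seq_fsetE.
  by apply/mapP; exists m.
by rewrite big_seq1.
Qed.

Record laurent_fun : Type := LaurentFun {
  fcn :> 'rV[R]_n -> trop R;
  fcnP : is_laurent_fun fcn }.

HB.instance Definition _ := gen_eqMixin laurent_fun.
HB.instance Definition _ := gen_choiceMixin laurent_fun.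

Lemma laurent_fun_ext (f g : laurent_fun) : f =1 g -> f = g.
Proof.
case: f g => [f Pf] [g Pg] /= /funext fg.
by subst g; congr LaurentFun; exact: Prop_irrelevance.
Qed.

Lemma is_laurent_fun0 : is_laurent_fun (fun=> 0).
Proof.
have := is_laurent_fun_seq [::]; congr (is_laurent_fun _).
by apply/funext => p; rewrite big_nil.
Qed.

Lemma is_laurent_fun1 : is_laurent_fun (fun=> 1).
Proof.
have := is_laurent_fun_seq [:: (0, 1)]; congr (is_laurent_fun _).
by apply/funext => p; rewrite big_seq1 /= zdot0 mul1r.
Qed.

Lemma is_laurent_funD (f g : laurent_fun) :
  is_laurent_fun (fun p => f p + g p).
Proof.
have [P ->] := fcnP f; have [Q ->] := fcnP g.
have := is_laurent_fun_seq
  ([seq (u, P u) | u <- finsupp P] ++ [seq (u, Q u) | u <- finsupp Q]).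
by congr (is_laurent_fun _); apply/funext => p; rewrite big_cat !big_map.
Qed.

Lemma is_laurent_funM (f g : laurent_fun) :
  is_laurent_fun (fun p => f p * g p).
Proof.
have [P ->] := fcnP f; have [Q ->] := fcnP g.
have := is_laurent_fun_seq
  [seq (u + v, P u * Q v) | u <- finsupp P, v <- finsupp Q].
congr (is_laurent_fun _); apply/funext => p.
rewrite big_allpairs_dep /= mulr_suml; apply: eq_bigr => u _.
rewrite mulr_sumr; apply: eq_bigr => v _ /=; rewrite mulrACA.
by rewrite zdotD.
Qed.

Definition laurent_fun0 := LaurentFun is_laurent_fun0.
Definition laurent_fun1 := LaurentFun is_laurent_fun1.
Definition laurent_fun_add f g := LaurentFun (is_laurent_funD f g).
Definition laurent_fun_mul f g := LaurentFun (is_laurent_funM f g).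

Lemma laurent_fun_addA : associative laurent_fun_add.
Proof. by move=> f g h; apply: laurent_fun_ext => p /=; rewrite addrA. Qed.
Lemma laurent_fun_addC : commutative laurent_fun_add.
Proof. by move=> f g; apply: laurent_fun_ext => p /=; rewrite addrC. Qed.
Lemma laurent_fun_add0 : left_id laurent_fun0 laurent_fun_add.
Proof. by move=> f; apply: laurent_fun_ext => p /=; rewrite add0r. Qed.
HB.instance Definition _ := GRing.isNmodule.Build laurent_fun
  laurent_fun_addA laurent_fun_addC laurent_fun_add0.

Lemma laurent_fun_mulA : associative laurent_fun_mul.
Proof. by move=> f g h; apply: laurent_fun_ext => p /=; rewrite mulrA. Qed.
Lemma laurent_fun_mulC : commutative laurent_fun_mul.
Proof. by move=> f g; apply: laurent_fun_ext => p /=; rewrite mulrC. Qed.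
Lemma laurent_fun_mul1 : left_id laurent_fun1 laurent_fun_mul.
Proof. by move=> f; apply: laurent_fun_ext => p /=; rewrite mul1r. Qed.
Lemma laurent_fun_mulDl : left_distributive laurent_fun_mul laurent_fun_add.
Proof. by move=> f g h; apply: laurent_fun_ext => p /=; rewrite mulrDl. Qed.
Lemma laurent_fun_mul0 : left_zero laurent_fun0 laurent_fun_mul.
Proof. by move=> f; apply: laurent_fun_ext => p /=; rewrite mul0r. Qed.
HB.instance Definition _ := GRing.Nmodule_isComPzSemiRing.Build laurent_fun
  laurent_fun_mulA laurent_fun_mulC laurent_fun_mul1 laurent_fun_mulDl
  laurent_fun_mul0.

End LaurentFunctions.

Section Congruences.
Variable S : comPzSemiRingType.

Record congruence (E : set (S * S)) : Prop := Congruence {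
  congr_refl : forall x, E (x, x);
  congr_sym : forall x y, E (x, y) -> E (y, x);
  congr_trans : forall x y z, E (x, y) -> E (y, z) -> E (x, z);
  congr_add : forall x y x' y',
    E (x, y) -> E (x', y') -> E (x + x', y + y');
  congr_mul : forall x y x' y',
    E (x, y) -> E (x', y') -> E (x * x', y * y') }.

Lemma congruence_smallest (A : set (S * S)) :
  congruence (smallest congruence A).
Proof.
split.
- by move=> x M [cM _]; exact: congr_refl cM x.
- by move=> x y H M AM; exact: (congr_sym AM.1) (H M AM).
- by move=> x y z H H' M AM; exact: (congr_trans AM.1) (H M AM) (H' M AM).
- by move=> x y x' y' H H' M AM; exact: (congr_add AM.1) (H M AM) (H' M AM).
- by move=> x y x' y' H H' M AM; exact: (congr_mul AM.1) (H M AM) (H' M AM).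
Qed.

Definition finitely_generated_congruence (E : set (S * S)) : Prop :=
  exists A : set (S * S), finite_set A /\ E = smallest congruence A.

End Congruences.

Definition restriction_congruence (R : realType) (n : nat) (Z : set 'rV[R]_n) :
    set (laurent_fun R n * laurent_fun R n) :=
  [set fg : laurent_fun R n * laurent_fun R n |
    forall p, Z p -> fg.1 p = fg.2 p].

Lemma congruence_restriction (R : realType) (n : nat) (Z : set 'rV[R]_n) :
  congruence (restriction_congruence Z).
Proof.
split=> //=.
- by move=> f g fg p Zp; rewrite fg.
- by move=> f g h fg gh p Zp; rewrite fg ?gh.
- by move=> f g f' g' fg fg' p Zp /=; rewrite fg ?fg'.
- by move=> f g f' g' fg fg' p Zp /=; rewrite fg ?fg'.
Qed.

Section Polyhedra.
Variables (R : realType) (n : nat).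
Implicit Types (s t : set 'rV[R]_n) (X : set (set 'rV[R]_n)).

Definition rational_polyhedron s : Prop :=
  s !=set0 /\
  exists (m : nat) (a : 'I_m -> 'rV[int]_n) (b : 'I_m -> R),
    (forall i, a i != 0) /\ s = [set p | forall i, 0 <= zdot (a i) p + b i].

Definition affine_form (c : 'rV[R]_n) (b : R) (p : 'rV[R]_n) : R :=
  \sum_(i < n) c 0 i * p 0 i + b.

Definition face t s : Prop :=
  t = s \/
  t !=set0 /\
  exists (c : 'rV[R]_n) (b : R),
    (forall p, s p -> 0 <= affine_form c b p) /\
    t = s `&` [set p | affine_form c b p = 0].

Definition affine_span s : set 'rV[R]_n :=
  [set x | exists (k : nat) (c : 'I_k -> R) (v : 'I_k -> 'rV[R]_n),
     [/\ forall i, s (v i), \sum_(i < k) c i = 1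
       & x = \sum_(i < k) c i *: v i]].

Definition linear_part s : set 'rV[R]_n :=
  [set x - y | x in affine_span s & y in affine_span s].

(* For nonempty [s], [linear_part s] is a linear subspace, so that there is a *)
(* unique such [d]. *)
Definition has_dim s (d : nat) : Prop :=
  exists U : {vspace 'rV[R]_n}, [set` U] = linear_part s /\ \dim U = d.

Definition lattice s : set 'rV[int]_n :=
  [set u | linear_part s (map_mx intr u)].

Definition face_connected X : Prop :=
  forall s t, X s -> X t ->
    exists (k : nat) (c : nat -> set 'rV[R]_n),
      [/\ c 0%N = s, c k = t, forall i, (i <= k)%N -> X (c i)
        & forall i, (i < k)%N -> face (c i) (c i.+1) \/ face (c i.+1) (c i)].

Record polyhedral_complex X : Prop := PolyhedralComplex {
  complex_nonempty : X !=set0;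
  complex_finite : finite_set X;
  complex_polyhedron : forall s, X s -> rational_polyhedron s;
  complex_face : forall s t, X s -> face t s -> X t;
  complex_inter : forall s t, X s -> X t -> s `&` t !=set0 ->
    face (s `&` t) s /\ face (s `&` t) t;
  complex_connected : face_connected X }.

Definition complex_support X : set 'rV[R]_n := \bigcup_(s in X) s.

Definition facet X s : Prop :=
  X s /\ forall t, X t -> s `<=` t -> t = s.

Definition pure_dim X (d : nat) : Prop := forall s, facet X s -> has_dim s d.

Definition lattice_normal t s (u : 'rV[int]_n) : Prop :=
  s `<=` [set x + a *: map_mx intr u | x in affine_span t
                                    & a in [set a : R | 0 <= a]] /\
  lattice s = [set v + u *~ k | v in lattice t & k in [set: int]].

Definition facets_around X t : set (set 'rV[R]_n) :=
  [set s | facet X s /\ face t s].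

(* [u s] plays the role of the vector u_{s/t}: the condition is required for *)
(* every choice of these vectors. *)
Definition balanced X (w : set 'rV[R]_n -> nat) (d : nat) : Prop :=
  forall t, X t -> (exists2 k, has_dim t k & d = k.+1) ->
  forall u : set 'rV[R]_n -> 'rV[int]_n,
    (forall s, facets_around X t s -> lattice_normal t s (u s)) ->
    lattice t (\sum_(s \in facets_around X t) u s *+ w s).

End Polyhedra.

(* Only the values of [tv_weight] on facets are relevant. *)
Record tropical_variety (R : realType) (n : nat) : Type := TropicalVariety {
  tv_cells :> set (set 'rV[R]_n);
  tv_complex : polyhedral_complex tv_cells;
  tv_dim : nat;
  tv_pure : pure_dim tv_cells tv_dim;
  tv_weight : set 'rV[R]_n -> nat;
  tv_weight_gt0 : forall s, facet tv_cells s -> (0 < tv_weight s)%N;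
  tv_balanced : balanced tv_cells tv_weight tv_dim }.

Definition rational_affine_subspace (R : realType) (n : nat)
    (Z : set 'rV[R]_n) : Prop :=
  exists (p : 'rV[R]_n) (d : nat) (q : 'I_d -> 'rV[int]_n),
    Z = [set p + \sum_(i < d) c i *: map_mx intr (q i) | c in [set: 'I_d -> R]].

(* Main.v *)
(** If [Z = |X|] is an affine subspace, an integer projector onto its direction
    gives a retraction [pi] of [R^n] onto [Z] such that [f o pi] is a Laurent
    function for each Laurent function [f]; finitely many relations between a
    monomial and a constant make [f] and [f o pi] congruent.

    Conversely, let [E(Z)] be generated by finitely many pairs. By balancing, a
    facet direction transverse to a subspace [K] forces [Z + K = R^n]; hence a
    linear form bounded above on [Z] is constant on [Z], and [Z] is an affine
    subspace as soon as the direction of some facet contains the directions of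
    all cells. Otherwise there is an integer vector [t], a combination of
    directions of cells, which lies in the direction of no facet and is
    orthogonal to the difference of two exponents of a generator only if that
    difference is constant on [Z]. Take [f] with [f (x + e t) = f x - e |t|^2]
    which is nonnegative on [Z], so that [f] and [max (f, 0)] agree on [Z]. If
    [max (a g, b) = f] on [Z + R t] for a generator [(g, h)], then all exponents
    of [g], hence by the above those of [h], have the same product with [t], so
    [g = h] on [Z + R t] and [max (a h, b) = f] there. Thus every function
    congruent to [f] equals [f] on [Z + R t], which [max (f, 0)] does not. *)
Require Import Defs.
From mathcomp Require Import all_boot all_order all_algebra.
From mathcomp Require Import finmap.
From mathcomp Require Import all_classical all_reals.
From mathcomp Require Import ring lra zify.

Set Implicit Arguments.
Unset Strict Implicit.
Unset Printing Implicit Defensive.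

Import Order.TTheory GRing.Theory Num.Theory.

Local Open Scope classical_set_scope.
Local Open Scope ring_scope.

(** * Congruences and integer projectors *)

Section SyntacticCongruence.
Variable S : comPzSemiRingType.

(** The largest congruence whose classes respect [P]. To show that a generated congruence preserves
    [P], it suffices to exchange generators inside contexts [a * _ + b]. *)
Definition syntactic_congruence (P : S -> Prop) : set (S * S) :=
  [set xy | forall a b, P (a * xy.1 + b) <-> P (a * xy.2 + b)].

Lemma congruence_syntactic (P : S -> Prop) :
  congruence (syntactic_congruence P).
Proof.
split=> //=.
- by move=> x y xy a b; split=> /xy.
- by move=> x y z xy yz a b; split=> [/xy/yz|/yz/xy].
- move=> x y x' y' xy xy' a b; have /= := xy a (a * x' + b).
  have /= := xy' a (a * y + b); rewrite !mulrDr !addrA.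
  by rewrite ![a * y + _]addrC => -[H1 H2] [H3 H4]; split=> [/H3/H1|/H2/H4].
- move=> x y x' y' xy xy' a b; have /= := xy (a * x') b.
  have /= := xy' (a * y) b; rewrite -!mulrA ![x' * _]mulrC.
  by move=> [H1 H2] [H3 H4]; split=> [/H3/H1|/H2/H4].
Qed.

End SyntacticCongruence.

(** * Integer projectors from the Smith normal form *)

Section IntegerProjectors.

Lemma integer_smith_data (m n : nat) (M : 'M[int]_(m, n)) :
  exists L P : 'M[int]_m, exists N Q : 'M[int]_n, exists d : seq int,
  [/\ L *m P = 1%:M, P *m L = 1%:M, N *m Q = 1%:M, Q *m N = 1%:M
    & M = L *m (\matrix_(i, j) (d`_i *+ (i == j :> nat))) *m N].
Proof.
have [L Lu [N Nu [d _ ->]]] := int_Smith_normal_form M.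
by exists L, (invmx L), N, (invmx N), d; rewrite !mulmxV ?mulVmx.
Qed.

Variable R : realFieldType.

Local Notation realmx := (map_mx (intr : int -> R)).

(** In the coordinates of the Smith form the left kernel is spanned by coordinate vectors; [B] is
    the coordinate projector [E] onto it, conjugated by [L]. *)
Lemma integer_kernel_projector (m n : nat) (M : 'M[int]_(m, n)) :
  exists B : 'M[int]_m, B *m M = 0 /\
    forall v : 'rV[R]_m, v *m realmx M = 0 -> v *m realmx B = v.
Proof.
have [L [P [N [Q [d [LP PL NQ QN ->]]]]]] := integer_smith_data M.
set D := \matrix_(i, j) _.
(* A coordinate is free if its diagonal entry vanishes or if [D] has no such column. *)
pose E : 'M[int]_m := diag_mx (\row_i ((i < n)%N ==> (d`_i == 0))%:R).
exists (L *m E *m P); split.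
  have ED : E *m D = 0.
    apply/matrixP => i j; rewrite mul_diag_mx !mxE.
    case: (i =P j :> nat) => [ij|_]; last by rewrite /= mulr0.
    by rewrite ij ltn_ord /=; case: eqP => [->|_]; rewrite ?mul0rn ?mulr0 ?mul0r.
  by rewrite -!mulmxA (mulmxA P) PL mul1mx (mulmxA E) ED mul0mx mulmx0.
move=> v; rewrite !map_mxM => vM.
have {}vM : v *m realmx L *m realmx D = 0.
  have := congr1 (mulmx^~ (realmx Q)) vM.
  by rewrite mul0mx -!mulmxA -map_mxM NQ map_mx1 mulmx1.
have vE : v *m realmx L *m realmx E = v *m realmx L.
  rewrite /E map_diag_mx mul_mx_diag; apply/rowP => i; rewrite mxE.
  set w := v *m _ in vM *.
  rewrite !mxE; case: ltnP => [lin|_] /=; last by rewrite mulr1.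
  have /rowP/(_ (Ordinal lin)) := vM.
  rewrite !mxE (bigD1 i) //= big1 ?addr0 => [|j ji]; last first.
    by rewrite !mxE /= (_ : (j == i :> nat) = false) ?mulr0 //; apply/negbTE.
  rewrite !mxE eqxx mulr1n => /eqP; rewrite mulf_eq0 intr_eq0.
  by case/orP => [/eqP ->|->]; rewrite ?mul0r ?mulr1.
by rewrite !mulmxA vE -mulmxA -map_mxM LP map_mx1 mulmx1.
Qed.

(** Here [E] keeps the coordinates with nonzero diagonal entry. The factor [C] is only real, since
    [F] inverts those entries, while [B] stays integral. *)
Lemma integer_rowspace_projector (m n : nat) (M : 'M[int]_(m, n)) :
  exists (B : 'M[int]_n) (C : 'M[R]_(n, m)),
    M *m B = M /\ realmx B = C *m realmx M.
Proof.
have [L [P [N [Q [d [LP PL NQ QN ->]]]]]] := integer_smith_data M.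
set D := \matrix_(i, j) _.
pose E : 'M[int]_n := diag_mx (\row_i ((i < m)%N && (d`_i != 0))%:R).
pose F : 'M[R]_(n, m) := \matrix_(i, j) ((d`_i)%:~R^-1 *+ (i == j :> nat)).
exists (Q *m E *m N), (realmx Q *m F *m realmx P); split.
  have DE : D *m E = D.
    apply/matrixP => i j; rewrite mul_mx_diag !mxE.
    case: (i =P j :> nat) => [ij|_]; last by rewrite /= mul0r.
    by rewrite -ij ltn_ord /=; case: eqP => [->|_]; rewrite ?mul0rn ?mulr1 ?mul0r.
  by rewrite -!mulmxA (mulmxA N) NQ mul1mx (mulmxA D) DE.
have FD : F *m realmx D = realmx E.
  apply/matrixP => i j; rewrite map_diag_mx !mxE.
  case: (ltnP i m) => [lim|im] /=; last first.
    rewrite mul0rn big1 // => k _.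
    rewrite !mxE (_ : (i == k :> nat) = false) ?mul0r //.
    by apply/negbTE; rewrite gtn_eqF // (leq_trans _ im).
  rewrite (bigD1 (Ordinal lim)) //= big1 ?addr0 => [|k ki]; last first.
    rewrite !mxE (_ : (i == k :> nat) = false) ?mul0r //.
    by apply/negbTE; rewrite eq_sym.
  rewrite !mxE eqxx mulr1n /= -val_eqE /=; case: (i =P j :> nat) => _; last by rewrite /= mulr0.
  rewrite !mulr1n; have [->|d0] := eqVneq (d`_i) 0; first by rewrite mulr0.
  by rewrite mulVf ?intr_eq0.
rewrite !map_mxM !mulmxA; congr (_ *m _).
by rewrite -(mulmxA _ _ (realmx L)) -(map_mxM _ P) PL map_mx1 mulmx1 -mulmxA FD.
Qed.

End IntegerProjectors.

(** * Affine subspaces *)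

Section LaurentMonomials.
Variables (R : realType) (n : nat).
Implicit Types (u v : 'rV[int]_n) (p x : 'rV[R]_n) (f g : laurent_fun R n).

Lemma zdotE u p : zdot u p = (map_mx intr u *m p^T) 0 0.
Proof. by rewrite mxE; apply: eq_bigr => i _; rewrite !mxE. Qed.

Lemma zdotDr u p x : zdot u (p + x) = zdot u p + zdot u x.
Proof. by rewrite !zdotE linearD mulmxDr mxE. Qed.

Lemma zdotBr u p x : zdot u (p - x) = zdot u p - zdot u x.
Proof. by rewrite !zdotE linearB mulmxBr !mxE. Qed.

Lemma zdotZr u (a : R) p : zdot u (a *: p) = a * zdot u p.
Proof. by rewrite !zdotE linearZ -scalemxAr mxE. Qed.

Lemma zdotBl u v p : zdot (u - v) p = zdot u p - zdot v p.
Proof.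
rewrite zdotD; congr (_ + _); rewrite /zdot -sumrN; apply: eq_bigr => i _.
by rewrite mxE rmorphN mulNr.
Qed.

Lemma zdot_mulmx u (B : 'M[int]_n) p :
  zdot (u *m B^T) p = zdot u (p *m map_mx intr B).
Proof. by rewrite !zdotE map_mxM -map_trmx trmx_mul mulmxA. Qed.

Lemma is_laurent_fun_monomial u (c : R) :
  is_laurent_fun (fun p => Fin (zdot u p + c)).
Proof.
have := is_laurent_fun_seq (R := R) [:: (u, Fin c)]; congr is_laurent_fun.
by apply/funext => p; rewrite big_seq1 /= addrC.
Qed.

Definition monomial u c : laurent_fun R n :=
  LaurentFun (is_laurent_fun_monomial u c).

Lemma monomialM u v (a b : R) :
  monomial u a * monomial v b = monomial (u + v) (a + b).
Proof.
by apply: laurent_fun_ext => p; rewrite /= zdotD; congr Fin; ring.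
Qed.

Lemma fcn_sum (I : Type) (r : seq I) (F : I -> laurent_fun R n) p :
  (\sum_(i <- r) F i : laurent_fun R n) p = \sum_(i <- r) F i p.
Proof. by apply: (big_morph (fun f : laurent_fun R n => f p)). Qed.

Lemma laurent_fun_monomials f :
  exists s : seq ('rV[int]_n * R), f = \sum_(m <- s) monomial m.1 m.2.
Proof.
have [P fP] := fcnP f.
exists [seq (u, if P u is Fin c then c else 0) | u <- finsupp P].
apply: laurent_fun_ext => p; rewrite fP fcn_sum big_map /trop_eval.
apply: eq_big_seq => u; rewrite mem_finsupp.
by case: (P u) => [/eqP//|c] _; rewrite /= addrC.
Qed.

End LaurentMonomials.

(** * Finite generation over an affine subspace *)

Section AffineSubspaceCongruence.
Variables (R : realType) (n : nat).
Implicit Types (u v : 'rV[int]_n) (p x : 'rV[R]_n) (f g : laurent_fun R n).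

Section Pinned.
Variables (G : set (laurent_fun R n * laurent_fun R n)) (p : 'rV[R]_n).
Hypothesis congrG : congruence G.

(** Modulo [G] the monomial becomes a constant, its value at [p]. Such exponents form a subgroup, so
    finitely many relations pin a whole lattice. *)
Let pinned u := G (monomial u 0, monomial 0 (zdot u p)).

Let pinnedD u v : pinned u -> pinned v -> pinned (u + v).
Proof.
move=> Gu Gv; have := congr_mul congrG Gu Gv.
by rewrite !monomialM !addr0 -zdotD.
Qed.

Let pinnedN u : pinned u -> pinned (- u).
Proof.
move=> Gu; have := congr_mul congrG Gu
  (congr_refl congrG (monomial (- u) (- zdot u p))).
rewrite !monomialM !add0r !subrr => /(congr_sym congrG).
by rewrite /pinned -[- u]add0r zdotBl zdot0 !add0r.
Qed.

Let pinned_scale (k : int) u : pinned u -> pinned (k *: u).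
Proof.
move=> Gu; have nat_scale (m : nat) : pinned (m%:Z *: u).
  elim: m => [|m IHm]; last by rewrite intS scalerDl scale1r; exact: pinnedD.
  by rewrite scale0r /pinned zdot0; exact: congr_refl.
case: k => m; first exact: nat_scale.
by rewrite NegzE scaleNr; exact/pinnedN/nat_scale.
Qed.

Lemma pinned_mulmx (B : 'M[int]_n) :
  (forall j, pinned (row j B)) -> forall u, pinned (u *m B).
Proof.
move=> GB u; rewrite mulmx_sum_row; elim/big_rec: _ => [|i w _ Gw].
  by rewrite /pinned zdot0; exact: congr_refl.
by apply: pinnedD => //; exact: pinned_scale.
Qed.

Lemma congruence_monomial_shift u v (c : R) : pinned (u - v) ->
  G (monomial u c, monomial v (c + zdot (u - v) p)).
Proof.
move=> /(congr_mul congrG (congr_refl congrG (monomial v c))).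
by rewrite !monomialM !addr0 addrC subrK.
Qed.

End Pinned.

Lemma finitely_generated_restriction_affine (Z : set 'rV[R]_n) :
  rational_affine_subspace Z ->
  finitely_generated_congruence (restriction_congruence Z).
Proof.
move=> [p [d [q ->{Z}]]]; set Z := [set _ | _ in _].
have [B [C [QB BQ]]] :=
  integer_rowspace_projector R (\matrix_(i < d) q i).
(* Composing with [pi] turns an exponent [u] into [u *m B^T]; the rows of [T] generate the
   differences [u *m T], which have to be pinned. *)
pose T : 'M[int]_n := 1%:M - B^T.
pose pi x := p + (x - p) *m map_mx intr B.
have sumE (c : 'I_d -> R) : \sum_i c i *: map_mx intr (q i)
    = \row_i c i *m map_mx intr (\matrix_(i < d) q i) :> 'rV[R]_n.
  rewrite mulmx_sum_row; apply: eq_bigr => i _.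
  by rewrite mxE -map_row rowK.
have piZ x : Z (pi x).
  exists (fun i => ((x - p) *m C) 0 i) => //; rewrite sumE /pi BQ mulmxA.
  by congr (_ + _ *m _); apply/rowP => i; rewrite mxE.
have piK x : Z x -> pi x = x.
  move=> [c _ <-]; rewrite /pi [_ + _ - p]addrAC subrr add0r sumE.
  by rewrite -mulmxA -map_mxM QB.
have TE u : u *m T = u - u *m B^T by rewrite mulmxBr mulmx1.
pose gen j : laurent_fun R n * laurent_fun R n :=
  (monomial (row j T) 0, monomial 0 (zdot (row j T) p)).
pose A := [set` [seq gen j | j <- enum 'I_n]].
exists A; split; first exact: finite_seq.
(* The generators hold on [Z] because [pi] fixes [Z] pointwise. *)
apply/seteqP; split; last first.
  apply: smallest_sub; first exact: congruence_restriction.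
  move=> _ /mapP[j _ ->] x Zx /=; rewrite zdot0 add0r addr0; congr Fin.
  rewrite rowE TE !zdotBl !zdot_mulmx -!zdotBr; congr zdot.
  apply/eqP; rewrite subr_eq addrAC -subr_eq0 -addrA -mulmxBl subr_eq0 eq_sym.
  by apply/eqP/piK.
move=> [f g] fg; have congrG := congruence_smallest A.
set G := smallest (@congruence _) A in congrG *.
(* Shifting every monomial modulo [G] turns [h] into [h \o pi], which depends only on the values of
   [h] on [Z]. *)
have retract h : exists2 h' : laurent_fun R n, G (h, h') & h' =1 h \o pi.
  have [s ->] := laurent_fun_monomials h.
  exists (\sum_(m <- s)
    monomial (m.1 *m B^T) (m.2 + zdot (m.1 - m.1 *m B^T) p)).
    elim: s => [|m s IHs]; first by rewrite !big_nil; exact: (congr_refl congrG).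
    rewrite !big_cons; apply: (congr_add congrG) => //.
    apply: (congruence_monomial_shift congrG); rewrite -TE.
    apply: (pinned_mulmx congrG) => j D [_]; apply.
    by apply: (map_f gen); rewrite mem_enum.
  move=> x; rewrite /= !fcn_sum; apply: eq_bigr => m _ /=; congr Fin.
  by rewrite /pi zdotDr -zdot_mulmx zdotBr zdotBl; ring.
have [f' Gf f'E] := retract f; have [g' Gg g'E] := retract g.
have fg' : f' = g'.
  by apply: laurent_fun_ext => x; rewrite f'E g'E /=; exact: fg.
by apply: (congr_trans congrG Gf); rewrite fg'; exact: (congr_sym congrG).
Qed.

End AffineSubspaceCongruence.

(** * Rational polyhedra *)

Section SmallParameters.
Variable R : realFieldType.
Implicit Types (P Q : R -> Prop) (e a b : R).

(** Validity on a right neighbourhood of 0. Stability under finite conjunction and rescaling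
    replaces explicit choices of epsilons. *)
Definition for_small P : Prop :=
  exists2 e, 0 < e & forall e', 0 <= e' <= e -> P e'.

Lemma for_small_and P Q :
  for_small P -> for_small Q -> for_small (fun e => P e /\ Q e).
Proof.
move=> [d d0 Pd] [e e0 Qe]; exists (Num.min d e); first by rewrite lt_min d0.
by move=> e' /andP[e'0]; rewrite le_min => /andP[? ?]; split;
  [apply: Pd|apply: Qe]; apply/andP.
Qed.

Lemma for_small_imp P Q :
  (forall e, 0 <= e -> P e -> Q e) -> for_small P -> for_small Q.
Proof.
move=> PQ [e e0 Pe]; exists e => // e' e'e; apply: PQ; last exact: Pe.
by case/andP: e'e.
Qed.

Lemma for_small_scale P a : 0 <= a -> for_small P -> for_small (P \o *%R a).
Proof.
move=> a0 [e e0 Pe]; exists (e / (a + 1)); first by rewrite divr_gt0 // ltr_wpDl.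
move=> e' /andP[e'0 e'e] /=; apply: Pe; rewrite mulr_ge0 //=.
have a1 : 0 < a + 1 by rewrite ltr_wpDl.
move: e'e; rewrite ler_pdivlMr // mulrC; apply: le_trans.
by rewrite ler_wpM2r // lerDl ler01.
Qed.

Lemma for_small_seq (I : eqType) (s : seq I) (P : I -> R -> Prop) :
  (forall i, i \in s -> for_small (P i)) ->
  for_small (fun e => forall i, i \in s -> P i e).
Proof.
elim: s => [_|i s IHs Ps]; first by exists 1.
have Pi := Ps i (mem_head i s).
have {}IHs := IHs (fun j js => Ps j (mem_behead (s := i :: s) js)).
apply: for_small_imp (for_small_and Pi IHs) => e _ [Pie Pse] j.
by rewrite inE => /predU1P[->|/Pse].
Qed.

Lemma for_small_fin (I : finType) (P : I -> R -> Prop) :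
  (forall i, for_small (P i)) -> for_small (fun e => forall i, P i e).
Proof.
move=> Pi; have := @for_small_seq _ (enum I) P (fun i _ => Pi i).
by apply: for_small_imp => e _ Pe i; apply: Pe; rewrite mem_enum.
Qed.

Lemma for_small_gt0 a b : 0 < a -> for_small (fun e => 0 < a + e * b).
Proof.
move=> a0; exists (a / (2 * (`|b| + 1))).
  by rewrite divr_gt0 ?mulr_gt0 // ltr_wpDl.
move=> e /andP[e0]; have b1 : 0 < `|b| + 1 by rewrite ltr_wpDl.
rewrite ler_pdivlMr ?mulr_gt0 // => ea.
have : - (e * `|b|) <= e * b by rewrite -mulrN ler_wpM2l // lerNl ler_normr lexx orbT.
by have := mulr_ge0 e0 (normr_ge0 b); nra.
Qed.

Lemma for_small_witness P : for_small P -> exists2 e, 0 < e & P e.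
Proof. by move=> [e e0 Pe]; exists e => //; apply: Pe; rewrite ltW /=. Qed.

End SmallParameters.

(** * Linear functionals and subspaces *)

Section DotProduct.
Variables (R : realFieldType) (n : nat).
Implicit Types (c x y v : 'rV[R]_n) (W : {vspace 'rV[R]_n}).

Definition dot c x : R := \sum_(i < n) c 0 i * x 0 i.

Lemma dotC c x : dot c x = dot x c.
Proof. by apply: eq_bigr => i _; rewrite mulrC. Qed.

Lemma dotDr c x y : dot c (x + y) = dot c x + dot c y.
Proof. by rewrite -big_split; apply: eq_bigr => i _; rewrite mxE mulrDr. Qed.

Lemma dotZr c (a : R) x : dot c (a *: x) = a * dot c x.
Proof. by rewrite mulr_sumr; apply: eq_bigr => i _; rewrite mxE mulrCA. Qed.

Lemma dotZl (a : R) c x : dot (a *: c) x = a * dot c x.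
Proof. by rewrite dotC dotZr dotC. Qed.

Lemma dotNr c x : dot c (- x) = - dot c x.
Proof. by rewrite -scaleN1r dotZr mulN1r. Qed.

Lemma dotBr c x y : dot c (x - y) = dot c x - dot c y.
Proof. by rewrite dotDr dotNr. Qed.

Lemma dot0r c : dot c 0 = 0.
Proof. by rewrite -(scale0r 0) dotZr mul0r. Qed.

Lemma dot_sumr (I : Type) (r : seq I) (P : pred I) c (F : I -> 'rV[R]_n) :
  dot c (\sum_(i <- r | P i) F i) = \sum_(i <- r | P i) dot c (F i).
Proof. exact: (big_morph (dot c) (dotDr c) (dot0r c)). Qed.

Lemma dot_eq0 c : (forall x, dot c x = 0) -> c = 0.
Proof.
move=> c0; apply/rowP => i; rewrite mxE; have := c0 (delta_mx 0 i).
rewrite /dot (bigD1 i) //= !mxE !eqxx mulr1 big1 ?addr0 // => j ji.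
by rewrite mxE (negPf ji) andbF mulr0.
Qed.

Definition annihilates c W : Prop := forall w, w \in W -> dot c w = 0.

Lemma annihilates_add c W W' :
  annihilates c W -> annihilates c W' -> annihilates c (W + W')%VS.
Proof.
by move=> cW cW' _ /memv_addP[w /cW w0 [w' /cW' w'0 ->]]; rewrite dotDr w0 w'0 addr0.
Qed.

Lemma annihilates_line c x : dot c x = 0 -> annihilates c <[x]>%VS.
Proof. by move=> cx _ /vlineP[a ->]; rewrite dotZr cx mulr0. Qed.

Lemma annihilatesS c W W' : (W <= W')%VS -> annihilates c W' -> annihilates c W.
Proof. by move=> /subvP sW cW w /sW/cW. Qed.

Lemma annihilates_span c (X : seq 'rV[R]_n) :
  (forall x, x \in X -> dot c x = 0) -> annihilates c <<X>>%VS.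
Proof.
move=> cX w /(@coord_span _ _ _ (in_tuple X)) ->; rewrite dot_sumr big1 // => i _.
by rewrite dotZr cX ?mulr0 // mem_nth.
Qed.

(** Outside the row space of a basis matrix of [W], some column of the cokernel matrix does not
    vanish on [x]; normalized, it is the functional. *)
Lemma separating_functional W x :
  x \notin W -> exists2 c, annihilates c W & dot c x = 1.
Proof.
move=> xW; pose M := \matrix_(i < \dim W) (vbasis W)`_i.
have inW (D : 'rV_(\dim W)) : D *m M \in W.
  rewrite mulmx_sum_row memv_suml // => i _; rewrite memvZ // rowK.
  by apply: vbasis_mem; rewrite mem_nth // size_tuple.
have : ~~ (x <= M)%MS by apply: contra xW => /submxP[D ->].
rewrite submxE => /rV0Pn[j]; set K := cokermx M => xK.
pose c := (col j K)^T.
have dotE w : dot c w = (w *m K) 0 j.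
  by rewrite mxE; apply: eq_bigr => i _; rewrite !mxE mulrC.
exists (((x *m K) 0 j)^-1 *: c); last first.
  by rewrite dotZl dotE mulVf.
move=> w wW; rewrite dotZl dotE.
suff /rowP/(_ j) -> : w *m K = 0 by rewrite [X in _ * X]mxE mulr0.
apply/eqP; rewrite -submxE; apply/submxP.
exists (\row_i coord (vbasis W) i w); rewrite mulmx_sum_row {1}(coord_vbasis wW).
by apply: eq_bigr => i _; rewrite mxE rowK.
Qed.

Lemma dim_rVfull : \dim {: 'rV[R]_n} = n.
Proof. by rewrite dimvf /dim /= mul1n. Qed.

Lemma annihilator_exists W :
  (\dim W < n)%N -> exists2 c, c != 0 & annihilates c W.
Proof.
move=> dW; have : ~~ ({:'rV[R]_n} <= W)%VS.
  by apply/negP => /dimvS; rewrite dim_rVfull leqNgt dW.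
move=> /subvPn[x _ /separating_functional[c cW cx]]; exists c => //.
apply/eqP => c0; have := cx.
by rewrite c0 dotC dot0r => /eqP; rewrite eq_sym oner_eq0.
Qed.

Lemma annihilates_full c : annihilates c fullv -> c = 0.
Proof. by move=> cf; apply: dot_eq0 => x; apply: cf; rewrite memvf. Qed.

Lemma dim_lt_full W : W != fullv -> (\dim W < n)%N.
Proof.
move=> WT; rewrite -[ltnRHS]dim_rVfull ltn_neqAle dimvS ?subvf // andbT.
by apply: contra WT; rewrite eqEdim subvf /= => /eqP ->.
Qed.

Lemma full_of_dim W : (n <= \dim W)%N -> W = fullv.
Proof.
by move=> dW; apply/eqP; apply: contraLR dW => /dim_lt_full; rewrite ltnNge.
Qed.

Lemma addv_line_dim W x : x \notin W -> (\dim W < \dim (W + <[x]>))%N.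
Proof.
move=> xW; rewrite ltn_neqAle dimvS ?addvSl // andbT.
apply: contra xW => dW; have /eqP -> : (W == W + <[x]>)%VS.
  by rewrite eqEdim addvSl /= -(eqP dW).
by rewrite memvE addvSr.
Qed.

Lemma annihilated_hyperplane W c x :
  (n <= (\dim W).+1)%N -> c != 0 -> annihilates c W -> dot c x = 0 -> x \in W.
Proof.
move=> dW c0 cW cx; apply: contraR c0 => /addv_line_dim xW.
apply/eqP/annihilates_full; rewrite -(@full_of_dim (W + <[x]>)%VS).
  by apply: annihilates_add => //; apply: annihilates_line.
exact: leq_trans dW xW.
Qed.

End DotProduct.

(** * Faces and directions of polyhedra *)

Section Polyhedra.
Variables (R : realType) (n : nat).
Implicit Types (s t : set 'rV[R]_n) (c p v x y z : 'rV[R]_n).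

Lemma affine_formE c (b : R) p : affine_form c b p = dot c p + b.
Proof. by []. Qed.

Lemma zdot_dot (u : 'rV[int]_n) p : zdot u p = dot (map_mx intr u) p.
Proof. by apply: eq_bigr => i _; rewrite mxE. Qed.

Definition convex_set s : Prop :=
  forall x y (a : R), s x -> s y -> 0 <= a <= 1 -> s (x + a *: (y - x)).

Lemma polyhedron_convex s : rational_polyhedron s -> convex_set s.
Proof.
move=> [_ [m [a [b [_ ->]]]]] x y e /= sx sy /andP[e0 e1] i.
rewrite zdotDr zdotZr zdotBr; have := sx i; have := sy i; nra.
Qed.

Lemma convex_small s x y : convex_set s -> s x -> s y ->
  for_small (fun e => s (x + e *: (y - x))).
Proof. by move=> cs sx sy; exists 1 => // e e1; exact: cs. Qed.

(** Induction on the list: if the point [p] found for [r] lies on hyperplane [i], a small move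
    towards a point [q] off it leaves this hyperplane and meets none of the others. *)
Lemma generic_point (I : eqType) (r : seq I) (c : I -> 'rV[R]_n) (b : I -> R) s :
  convex_set s -> s !=set0 ->
  (forall i, i \in r -> exists2 x, s x & dot (c i) x + b i != 0) ->
  exists2 x, s x & forall i, i \in r -> dot (c i) x + b i != 0.
Proof.
move=> cs [x0 sx0]; elim: r => [_|i r IHr nz]; first by exists x0.
have {IHr}[j js|p sp rp] := IHr; first by apply: nz; rewrite inE js orbT.
have [q sq iq] := nz i (mem_head i r).
have [ip|ip] := eqVneq (dot (c i) p + b i) 0; last first.
  by exists p => // j; rewrite inE => /predU1P[->//|/rp].
have rsmall : for_small (fun e : R => forall j, j \in r ->
    dot (c j) (p + e *: (q - p)) + b j != 0).
  apply: for_small_seq => j /rp.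
  pose d := dot (c j) (q - p).
  have jE (e : R) : dot (c j) (p + e *: (q - p)) + b j = dot (c j) p + b j + e * d.
    by rewrite dotDr dotZr -/d addrAC.
  rewrite neq_lt => /orP[lt0|gt0].
    have : 0 < - (dot (c j) p + b j) by rewrite oppr_gt0.
    move=> /(for_small_gt0 (- d)); apply: for_small_imp => e _ e0.
    by rewrite jE lt_eqF // -oppr_gt0 opprD -mulrN.
  move: gt0 => /(for_small_gt0 d); apply: for_small_imp => e _ e0.
  by rewrite jE gt_eqF.
have [e e0 [se re]] := for_small_witness (for_small_and (convex_small cs sp sq) rsmall).
exists (p + e *: (q - p)) => // j; rewrite inE => /predU1P[->|/re//].
rewrite dotDr dotZr dotBr.
have -> : dot (c i) p = - b i by apply/eqP; rewrite -addr_eq0 ip.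
by rewrite opprK addrAC addNr add0r mulf_neq0 // gt_eqF.
Qed.

Lemma affine_span_combination s x y (a : R) :
  s x -> s y -> affine_span s (x + a *: (y - x)).
Proof.
move=> sx sy; exists 2, (fun i => if i == 0 then 1 - a else a),
  (fun i => if i == 0 then x else y).
split; first by move=> i; case: ifP.
  by rewrite !big_ord_recl big_ord0 /= addr0 subrK.
rewrite !big_ord_recl big_ord0 /= addr0 scalerBl scale1r scalerBr.
by rewrite addrA addrAC.
Qed.

Lemma sub_affine_span s : s `<=` affine_span s.
Proof. by move=> x sx; have := affine_span_combination 0 sx sx; rewrite scale0r addr0. Qed.

Lemma linear_part_sub s x y : s x -> s y -> linear_part s (x - y).
Proof. by move=> sx sy; exists x; [|exists y]; do ?exact: sub_affine_span. Qed.

Lemma linear_partS s t : s `<=` t -> linear_part s `<=` linear_part t.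
Proof.
move=> st; have sub x : affine_span s x -> affine_span t x.
  by move=> [k [c [v [sv c1 ->]]]]; exists k, c, v; split=> // i; apply: st.
by move=> _ [x /sub tx [y /sub ty <-]]; exists x => //; exists y.
Qed.

Lemma dot_affine_span s c (g : R) :
  (forall x, s x -> dot c x = g) -> forall x, affine_span s x -> dot c x = g.
Proof.
move=> sg x [k [a [v [sv a1 ->]]]]; rewrite dot_sumr.
under eq_bigr do rewrite dotZr sg //.
by rewrite -mulr_suml a1 mul1r.
Qed.

Lemma dot_linear_part s c (g : R) :
  (forall x, s x -> dot c x = g) -> forall v, linear_part s v -> dot c v = 0.
Proof.
move=> sg _ [x sx [y sy <-]].
by rewrite dotBr !(dot_affine_span sg) // subrr.
Qed.

(** Directional form of the relative interior, which for polyhedra agrees with the topological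
    one. *)
Definition relative_interior s z : Prop :=
  s z /\ forall v, linear_part s v -> for_small (fun e => s (z + e *: v)).

Section Presentation.
Variables (m : nat) (a : 'I_m -> 'rV[int]_n) (b : 'I_m -> R).
Let s := [set p | forall i, 0 <= zdot (a i) p + b i].

(** Inequalities that are strict at [z] survive small moves; the tight ones are controlled by the
    hypothesis on [v]. *)
Lemma presentation_small z v : s z ->
    (forall i, zdot (a i) z + b i = 0 -> 0 <= zdot (a i) v) ->
  for_small (fun e => s (z + e *: v)).
Proof.
move=> sz zv; apply: for_small_fin => i.
have := sz i; rewrite le_eqVlt => /orP[/eqP z0|].
  exists 1 => // e /andP[e0 _]; rewrite zdotDr zdotZr addrAC -z0 add0r.
  by rewrite mulr_ge0 ?zv.
move=> /(for_small_gt0 (zdot (a i) v)); apply: for_small_imp => e _ /ltW.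
by rewrite zdotDr zdotZr addrAC.
Qed.

Lemma presentation_interior_point : s !=set0 ->
  exists2 z, s z & forall i, zdot (a i) z + b i = 0 ->
                   forall x, s x -> zdot (a i) x + b i = 0.
Proof.
move=> s0; pose I := [seq i <- enum 'I_m | `[< exists2 x, s x & zdot (a i) x + b i != 0 >]].
have cs : convex_set s.
  move=> x y e /= sx sy /andP[e0 e1] i.
  rewrite zdotDr zdotZr zdotBr; have := sx i; have := sy i; nra.
have [|z sz zI] := @generic_point _ I (fun i => map_mx intr (a i)) b s cs s0.
  move=> i; rewrite mem_filter => /andP[/asboolP[x sx xi] _].
  by exists x => //; rewrite -zdot_dot.
exists z => // i iz x sx; apply/eqP/negP => /negP xi.
have /zI : i \in I by rewrite mem_filter mem_enum andbT; apply/asboolP; exists x.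
by rewrite -zdot_dot iz eqxx.
Qed.

(** For the converse, a small move along [v] stays in [s]; stretched by [e^-1] about [z], it
    exhibits [v] as a difference of points of the affine span. *)
Lemma presentation_linear_part z : s z ->
    (forall i, zdot (a i) z + b i = 0 -> forall x, s x -> zdot (a i) x + b i = 0) ->
  forall v, linear_part s v <->
    forall i, zdot (a i) z + b i = 0 -> zdot (a i) v = 0.
Proof.
move=> sz zI v; split=> [sv i /zI iI|iv].
  rewrite zdot_dot; apply: (dot_linear_part (g := - b i)) sv => x sx.
  by apply/eqP; rewrite -zdot_dot -addr_eq0; exact/eqP/iI.
have vsmall : for_small (fun e => s (z + e *: v)).
  by apply: presentation_small => // i /iv ->.
have [e e0 sev] := for_small_witness vsmall.
rewrite (_ : v = z + e^-1 *: (z + e *: v - z) - z); last first.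
  by rewrite addrC addKr addrC addKr scalerA mulVf ?gt_eqF // scale1r.
exists (z + e^-1 *: (z + e *: v - z)); first exact: affine_span_combination.
by exists z => //; exact: sub_affine_span.
Qed.

End Presentation.

(** The direction is the left kernel of the integer matrix [M] of implicit equalities; the rows of
    an integer projector onto this kernel span it. *)
Lemma polyhedron_linear_space s : rational_polyhedron s ->
  exists q : seq 'rV[int]_n,
    [set` <<[seq map_mx intr u | u <- q]>>%VS] = linear_part s.
Proof.
move=> [s0 [m [a [b [_ sE]]]]]; move: s0; rewrite sE.
move=> /presentation_interior_point[z sz zI].
have linE := presentation_linear_part sz zI.
pose M := \matrix_(j < n, i < m) (if zdot (a i) z + b i == 0 then a i 0 j else 0).
have [B [BM Bker]] := integer_kernel_projector R M.
have ME (v : 'rV[R]_n) i : (v *m map_mx intr M) 0 i =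
    if zdot (a i) z + b i == 0 then zdot (a i) v else 0.
  rewrite mxE; case: ifP => iz; last first.
    by rewrite big1 // => j _; rewrite !mxE iz mulr0.
  by apply: eq_bigr => j _; rewrite !mxE iz mulrC.
exists [seq row i B | i <- enum 'I_n].
apply/seteqP; split=> v /=.
  move=> vB; apply/linE => i iz.
  rewrite zdot_dot; apply: annihilates_span vB => _ /mapP[_ /mapP[j _ ->] ->].
  rewrite -zdot_dot; have := ME (map_mx intr (row j B)) i.
  by rewrite iz eqxx => <-; rewrite -map_mxM -row_mul BM row0 map_mx0 mxE.
move=> /linE iv; rewrite -[v]Bker; last first.
  by apply/rowP => i; rewrite ME mxE; case: eqP => // /iv.
rewrite mulmx_sum_row memv_suml // => j _; rewrite memvZ // memv_span //.
apply/mapP; exists (row j B); last by rewrite map_row.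
by apply/mapP; exists j; rewrite ?mem_enum.
Qed.

(** The sum of the inequalities tight at [z] is nonnegative on [s] and vanishes exactly where all of
    them are tight. It cuts out the required face. *)
Lemma relative_interior_face_exists s z : rational_polyhedron s -> s z ->
  exists t, face t s /\ relative_interior t z.
Proof.
move=> [_ [m [a [b [_ ->]]]]] sz; set s' := [set _ | _] in sz *.
pose J i := zdot (a i) z + b i == 0.
pose c : 'rV[R]_n := \sum_(i | J i) map_mx intr (a i).
pose d := \sum_(i | J i) b i.
have cE x : affine_form c d x = \sum_(i | J i) (zdot (a i) x + b i).
  rewrite affine_formE big_split /= dotC dot_sumr; congr (_ + _).
  by apply: eq_bigr => i _; rewrite zdot_dot dotC.
have c0 x : s' x -> 0 <= affine_form c d x.
  by move=> sx; rewrite cE sumr_ge0.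
have tP x : s' x -> affine_form c d x = 0 <-> forall i, J i -> zdot (a i) x + b i = 0.
  move=> sx; rewrite cE; split=> [/eqP|x0]; last by rewrite big1.
  rewrite psumr_eq0 // => /allP x0 i Ji; apply/eqP.
  by have := x0 i (mem_index_enum i); rewrite Ji.
have zt : affine_form c d z = 0 by apply/tP => // i /eqP.
exists (s' `&` [set x | affine_form c d x = 0]); split.
  by right; split; [exists z|exists c, d].
split=> // v vt; have v0 i : J i -> zdot (a i) v = 0.
  move=> Ji; rewrite zdot_dot; apply: (dot_linear_part (g := - b i)) vt => x [sx].
  by move=> /tP-/(_ sx) /(_ i Ji) /eqP; rewrite zdot_dot addr_eq0 => /eqP.
have : for_small (fun e => s' (z + e *: v)).
  by apply: presentation_small => // i /eqP/v0 ->.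
apply: for_small_imp => e _ se; split=> //; apply/(tP _ se) => i Ji.
by rewrite zdotDr zdotZr v0 // mulr0 addr0; exact/eqP.
Qed.

Lemma face_sub t s : face t s -> t `<=` s.
Proof. by case=> [->//|[_ [c [b [_ ->]]]] x []]. Qed.

(** The supporting form is nonnegative on [t] and zero at [z]. If it were positive at [x], a small
    move from [z] away from [x] would make it negative. *)
Lemma face_relative_interior t t' z :
  face t' t -> relative_interior t z -> t' z -> t' = t.
Proof.
case=> [//|[_ [c [b [c0 ->]]]] [tz zint] /= [_ cz]].
apply/seteqP; split=> [x []//|x tx]; split=> //=.
have [e e0 te] := for_small_witness (zint _ (linear_part_sub tz tx)).
move: (c0 _ tx) (c0 _ te) cz; rewrite /= !affine_formE dotDr dotZr dotBr => cx ce cz.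
apply/eqP; rewrite eq_le cx andbT.
have := mulr_ge0 (ltW e0) cx; nra.
Qed.

(** If all inequalities tight at [z] were identities on [s], then [z] would be in the relative
    interior of [s], forcing [t = s]. A tight inequality that is no identity works. *)
Lemma facet_supporting_inequality t s z :
  rational_polyhedron s -> face t s -> t != s -> relative_interior t z ->
  exists (u : 'rV[int]_n) (b : R),
  [/\ forall x, s x -> 0 <= zdot u x + b, forall x, t x -> zdot u x + b = 0
    & exists2 x, s x & 0 < zdot u x + b].
Proof.
move=> [_ [m [a [b [_ ->]]]]]; set s' := [set _ | _] => ts tNs zt.
have sz : s' z by apply: (face_sub ts); case: zt.
suff [i [iz [x sx xi]]] : exists i, zdot (a i) z + b i = 0 /\
    exists2 x, s' x & 0 < zdot (a i) x + b i.
  exists (a i), (b i); split; [by move=> y sy; exact: sy| |by exists x].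
  move=> y ty; apply/eqP; rewrite eq_le (face_sub ts ty i) andbT.
  have [_ /(_ _ (linear_part_sub zt.1 ty)) zy] := zt.
  have [e e0 te] := for_small_witness zy.
  have := face_sub ts te i; rewrite zdotDr zdotZr zdotBr.
  by have := mulr_ge0 (ltW e0) (face_sub ts ty i); nra.
apply: contrapT => nex; move/eqP: tNs; apply.
apply: face_relative_interior ts _ zt.1; split=> // v sv.
apply: presentation_small => // i iz; rewrite zdot_dot.
rewrite (dot_linear_part (g := - b i) _ sv) // => x sx.
apply/eqP; rewrite -addr_eq0 -zdot_dot; apply: contraT => xi.
by case: nex; exists i; split=> //; exists x => //; rewrite lt_def xi sx.
Qed.

End Polyhedra.

(** * Directions as vector spaces, and lattice normals *)

Section LinearSpace.
Variables (R : realType) (n : nat).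
Implicit Types (s t : set 'rV[R]_n) (c p v x y z : 'rV[R]_n).

(** The direction as a [vspace], which gives access to dimensions; the default 0 occurs only for the
    empty set. *)
Definition linear_space s : {vspace 'rV[R]_n} :=
  if pselect (exists U : {vspace 'rV[R]_n}, [set` U] = linear_part s) is left ex
  then projT1 (cid ex) else 0%VS.

Lemma linear_space_unique s (U : {vspace 'rV[R]_n}) :
  [set` U] = linear_part s -> linear_space s = U.
Proof.
rewrite /linear_space => UE; case: pselect => [ex|]; last by case; exists U.
case: cid => V /= VE; apply/vspaceP => x.
have xE : ([set` U] x) = ([set` V] x) by rewrite UE VE.
by apply/idP/idP; move: xE => /= ->.
Qed.

Lemma linear_space_dim s d : has_dim s d -> \dim (linear_space s) = d.
Proof. by move=> [U [UE <-]]; rewrite (linear_space_unique UE). Qed.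

Lemma linear_spaceP s : rational_polyhedron s ->
  forall v, v \in linear_space s <-> linear_part s v.
Proof.
by move=> /polyhedron_linear_space[q qE] v; rewrite (linear_space_unique qE) -qE.
Qed.

Lemma linear_space_span s : rational_polyhedron s ->
  exists q : seq 'rV[int]_n, linear_space s = <<[seq map_mx intr u | u <- q]>>%VS.
Proof.
by move=> /polyhedron_linear_space[q qE]; exists q; exact: linear_space_unique.
Qed.

Lemma linear_spaceS s t : rational_polyhedron s -> rational_polyhedron t ->
  s `<=` t -> (linear_space s <= linear_space t)%VS.
Proof.
move=> ps pt st; apply/subvP => v /linear_spaceP-/(_ ps) sv.
by apply/linear_spaceP => //; exact: linear_partS sv.
Qed.

Lemma linear_space_const s c : rational_polyhedron s ->
  annihilates c (linear_space s) -> forall x y, s x -> s y -> dot c x = dot c y.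
Proof.
move=> ps cs x y sx sy; apply/eqP; rewrite -subr_eq0 -dotBr cs //.
by apply/linear_spaceP => //; exact: linear_part_sub.
Qed.

Lemma const_annihilates s c (g : R) : rational_polyhedron s ->
  (forall x, s x -> dot c x = g) -> annihilates c (linear_space s).
Proof.
by move=> ps sg v /linear_spaceP-/(_ ps); exact: dot_linear_part sg v.
Qed.

(** An integer form [a] supporting [t] has kernel [linear_space t] inside [linear_space s]. Its
    values on the lattice of [s] form a subgroup of the integers, and [u] realizes the least
    positive one. *)
Lemma lattice_normal_exists t s z (k : nat) :
  rational_polyhedron s -> rational_polyhedron t -> face t s ->
  \dim (linear_space t) = k -> \dim (linear_space s) = k.+1 ->
  relative_interior t z -> exists u, lattice_normal t s u.
Proof.
move=> ps pt ts dt ds zt.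
have tNs : t != s by apply/eqP => E; move: ds; rewrite -E dt => /n_Sn.
have [a [b [sab tab [x0 sx0 x0ab]]]] := facet_supporting_inequality ps ts tNs zt.
have sub : (linear_space t <= linear_space s)%VS.
  by apply: linear_spaceS => //; exact: face_sub.
have at0 : annihilates (map_mx intr a) (linear_space t).
  apply: (const_annihilates (g := - b)) => // x tx.
  by apply/eqP; rewrite -zdot_dot -addr_eq0 tab.
have ker v : v \in linear_space s -> zdot a v = 0 -> v \in linear_space t.
  move=> sv av; apply: contraT => /addv_line_dim; rewrite dt => dtv.
  have sE : linear_space s = (linear_space t + <[v]>)%VS.
    apply/esym/eqP; rewrite eqEdim subv_add sub -memvE sv /= ds.
    exact: dtv.
  have as0 : annihilates (map_mx intr a) (linear_space s).
    by rewrite sE; apply: annihilates_add => //; apply: annihilates_line; rewrite -zdot_dot.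
  have := linear_space_const ps as0 sx0 (face_sub ts zt.1).
  rewrite -!zdot_dot => x0z; have := tab _ zt.1.
  by rewrite -x0z => ab0; move: x0ab; rewrite ab0 ltxx.
pose ia (v : 'rV[int]_n) : int := \sum_i a 0 i * v 0 i.
have iaE (v : 'rV[int]_n) : zdot a (map_mx intr v) = (ia v)%:~R :> R.
  by rewrite rmorph_sum; apply: eq_bigr => i _; rewrite mxE rmorphM.
have iaD (v w : 'rV[int]_n) : ia (v + w) = ia v + ia w.
  by rewrite -big_split; apply: eq_bigr => i _; rewrite mxE mulrDr.
have iaN (v : 'rV[int]_n) : ia (- v) = - ia v.
  by rewrite -sumrN; apply: eq_bigr => i _; rewrite mxE mulrN.
have iaZ (v : 'rV[int]_n) m : ia (v *~ m) = m * ia v.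
  rewrite -scaler_int intz mulr_sumr; apply: eq_bigr => i _.
  by rewrite mxE mulrCA.
have [q qE] := linear_space_span ps.
have [v0 v0s v0a] : exists2 v : 'rV[int]_n, map_mx intr v \in linear_space s & 0 < ia v.
  suff [v vs va] : exists2 v : 'rV[int]_n, map_mx intr v \in linear_space s & ia v != 0.
    move: va; rewrite neq_lt => /orP[va|]; last by exists v.
    exists (- v); last by rewrite iaN oppr_gt0.
    by rewrite map_mxN rpredN.
  apply: contrapT => nex.
  have as0 : annihilates (map_mx intr a) (linear_space s).
    rewrite qE; apply: annihilates_span => _ /mapP[v vq ->].
    rewrite -zdot_dot iaE; apply/eqP; rewrite intr_eq0; apply: contraT => va.
    by case: nex; exists v => //; rewrite qE memv_span // map_f.
  have := linear_space_const ps as0 sx0 (face_sub ts zt.1).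
  rewrite -!zdot_dot => x0z; have := tab _ zt.1.
  by rewrite -x0z => ab0; move: x0ab; rewrite ab0 ltxx.
pose good m := (0 < m)%N &&
  `[< exists2 v : 'rV[int]_n, map_mx intr v \in linear_space s & ia v = m%:Z >].
have good_ex : exists m, good m.
  exists `|ia v0|%N; rewrite /good absz_gt0 gt_eqF //=; apply/asboolP.
  by exists v0 => //; rewrite gez0_abs // ltW.
have [m /andP[m0 /asboolP[u us um]] m_min] := ex_minnP good_ex.
exists u; split.
  have au : 0 < zdot a (map_mx intr u : 'rV[R]_n) by rewrite iaE um ltr0z ltz_nat.
  move=> x sx; pose r := (zdot a x + b) / zdot a (map_mx intr u).
  exists (x - r *: map_mx intr u); last first.
    by exists r; rewrite ?subrK //= divr_ge0 ?sab // ltW.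
  rewrite -[x - _](subrK z) addrC.
  have lt : x - r *: map_mx intr u - z \in linear_space t.
    apply: ker.
      rewrite addrAC rpredB ?rpredZ //.
      apply/linear_spaceP => //; apply: linear_part_sub => //.
      exact: face_sub ts _ zt.1.
    rewrite !zdotBr zdotZr divfK ?gt_eqF //.
    by have := tab _ zt.1; lra.
  have /(zt.2 _)/for_small_witness[e e0 te] : linear_part t (x - r *: map_mx intr u - z).
    exact/linear_spaceP.
  have := affine_span_combination e^-1 zt.1 te.
  by rewrite [_ + e *: _ - z]addrAC subrr add0r scalerA mulVf ?gt_eqF // scale1r.
apply/seteqP; split=> [v /= vs|_ /= [v vt [j _ <-]]]; last first.
  apply/linear_spaceP => //; rewrite map_mxD rpredD //.
    by apply: (subvP sub); apply/linear_spaceP.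
  by rewrite -scaler_int intz map_mxZ rpredZ.
have {}vs : map_mx intr v \in linear_space s by apply/linear_spaceP.
(* Division with remainder: a nonzero remainder would be a smaller positive value of [ia]. *)
pose j := (ia v %/ m%:Z)%Z; exists (v - u *~ j); last first.
  by exists j => //; rewrite subrK.
have ws : map_mx intr (v - u *~ j) \in linear_space s.
  by rewrite map_mxB rpredB // -scaler_int intz map_mxZ rpredZ.
apply/linear_spaceP => //; apply: ker => //.
have wE : ia (v - u *~ j) = (ia v %% m%:Z)%Z.
  by rewrite iaD iaN iaZ um /modz.
rewrite iaE wE; apply/eqP; rewrite intr_eq0; apply: contraT => r0.
have := modz_ge0 (ia v) (d := m%:Z); have := ltz_pmod (ia v) (d := m%:Z).
rewrite ltz_nat m0 => /(_ isT) rm /(_ (lt0n_neq0 m0)) rge.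
have : good `|(ia v %% m%:Z)%Z|%N.
  rewrite /good absz_gt0 r0 /=; apply/asboolP; exists (v - u *~ j) => //.
  by rewrite gez0_abs.
move=> /m_min; rewrite leqNgt => /negP[].
by rewrite -ltz_nat gez0_abs.
Qed.

End LinearSpace.

(** * Balanced complexes *)

Section FiniteUnionMaximum.
Variable R : realType.

(** A point outside [A] is no limit of [A] from the left. This weak closedness is enough for maxima
    to be attained. *)
Definition left_closed (A : R -> Prop) : Prop :=
  forall T, ~ A T -> for_small (fun e => forall s, A s -> s <= T -> s <= T - e).

(** If every [A i] missed the supremum of the union, each would leave a gap below it; the smallest
    of finitely many gaps gives a contradiction. *)
Lemma finite_union_max (I : eqType) (r : seq I) (A : I -> R -> Prop) (M : R) :
  (forall i, i \in r -> left_closed (A i)) ->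
  (exists2 i, i \in r & exists2 s, A i s & s <= M) ->
  exists2 i, i \in r & exists T, [/\ A i T, T <= M &
    forall j s, j \in r -> A j s -> s <= M -> s <= T].
Proof.
move=> Acl [i0 i0r [s0 As0 s0M]].
pose B := [set s | s <= M /\ exists2 i, i \in r & A i s].
have B0 : B !=set0 by exists s0; split=> //; exists i0.
have ubM : ubound B M by move=> s [].
have Bsup : has_sup B by split=> //; exists M.
have supM : sup B <= M by apply: sup_le_ub.
have Ble s : B s -> s <= sup B by move=> Bs; apply: sup_upper_bound.
suff [i ir AT] : exists2 i, i \in r & A i (sup B).
  exists i => //; exists (sup B); split=> // j s jr As sM; apply: Ble.
  by split=> //; exists j.
apply: contrapT => nex.
have [e e0 eP] : exists2 e, 0 < e & forall i, i \in r ->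
    forall s, A i s -> s <= sup B -> s <= sup B - e.
  apply: for_small_witness; apply: for_small_seq => i ir; apply: Acl => // AT.
  by apply: nex; exists i.
have : sup B <= sup B - e.
  apply: sup_le_ub => // s Bs; have sB := Ble s Bs.
  by have [_ [i ir As]] := Bs; apply: eP ir _ As sB.
by lra.
Qed.

Lemma polyhedron_line_left_closed (n : nat) (s : set 'rV[R]_n) x l :
  rational_polyhedron s -> left_closed (fun e => s (x + e *: l)).
Proof.
move=> [_ [m [a [b [_ ->]]]]] T /=.
move=> /existsNP[i /negP]; rewrite -ltNge zdotDr zdotZr -oppr_gt0.
move=> /(for_small_gt0 (zdot (a i) l))[e e0 eP].
exists e => // e' /andP[e'0 e'e] s' /(_ i); rewrite zdotDr zdotZr => sP sT.
rewrite leNgt; apply/negP => sTe.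
have /eP : 0 <= T - s' <= e by apply/andP; split; lra.
by lra.
Qed.

End FiniteUnionMaximum.

(** * Cells and facets of a complex *)

Section Complexes.
Variables (R : realType) (n : nat).
Implicit Types (s t : set 'rV[R]_n) (c p v x y z : 'rV[R]_n).

Lemma finite_maximal (r : seq (set 'rV[R]_n)) s : s \in r ->
  exists2 t, t \in r & s `<=` t /\ forall t', t' \in r -> t `<=` t' -> t' = t.
Proof.
elim: r s => // u r IHr s.
have extend w : w \in r -> exists2 t, t \in u :: r & w `<=` t /\
    forall t', t' \in u :: r -> t `<=` t' -> t' = t.
  move=> /IHr[t tr [wt tmax]]; have [tu|tNu] := pselect (t `<=` u).
    exists u; rewrite ?mem_head //; split; first exact: subset_trans tu.
    move=> t'; rewrite inE => /predU1P[//|t'r] ut'.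
    have t't := tmax _ t'r (subset_trans tu ut').
    by apply/seteqP; split=> //; rewrite t't.
  exists t; rewrite ?inE ?tr ?orbT //; split=> // t'.
  by rewrite inE => /predU1P[->//|]; exact: tmax.
rewrite inE => /predU1P[->|]; last exact: extend.
have [[w wr uw]|nex] := pselect (exists2 w, w \in r & u `<=` w).
  have [t tr [wt tmax]] := extend w wr.
  by exists t => //; split=> //; exact: subset_trans wt.
exists u; rewrite ?mem_head //; split=> // t'.
by rewrite inE => /predU1P[//|t'r] ut'; case: nex; exists t'.
Qed.

(** As [s] has larger dimension than [t], some [x] in [s] has a positive component [r] along [u].
    The required point is the midpoint of a move towards [x] and a correcting move inside [t]. *)
Lemma lattice_normal_direction s t z (u : 'rV[int]_n) v (a : R) :
  rational_polyhedron s -> rational_polyhedron t -> face t s ->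
  (\dim (linear_space t) < \dim (linear_space s))%N ->
  relative_interior t z -> lattice_normal t s u ->
  v \in linear_space t -> 0 <= a ->
  for_small (fun e => s (z + e *: (v + a *: map_mx intr u))).
Proof.
move=> ps pt ts dts zt [su _] vt a0.
have sz := face_sub ts zt.1.
have decomp x : s x -> exists2 l, l \in linear_space t &
    exists2 r : R, 0 <= r & x - z = l + r *: map_mx intr u.
  move=> /su[y ty [r r0 <-]]; exists (y - z); last by exists r; rewrite // addrAC.
  apply/linear_spaceP => //; exists y => //.
  by exists z => //; apply: sub_affine_span; exact: zt.1.
have [x sx [l lt [r r0 xE]]] : exists2 x, s x & exists2 l, l \in linear_space t &
    exists2 r : R, 0 < r & x - z = l + r *: map_mx intr u.
  apply: contrapT => nex; move: dts; rewrite ltnNge => /negP; apply; apply: dimvS.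
  apply/subvP => w; apply: contraTT => /separating_functional[c ct cw].
  apply/negP => ws; have /eqP : dot c w = 0; last by rewrite cw oner_eq0.
  apply: (@const_annihilates _ _ s c (dot c z)) => // x sx.
  have [l lt [r r0 xE]] := decomp x sx.
  have r00 : r = 0.
    apply/eqP; rewrite eq_le r0 andbT leNgt; apply/negP => rgt0.
    by apply: nex; exists x => //; exists l => //; exists r.
  by apply/eqP; rewrite -subr_eq0 -dotBr xE r00 scale0r addr0 ct.
have cs := polyhedron_convex ps.
have small1 : for_small (fun e => s (z + (2 * (a / r) * e) *: (x - z))).
  apply: (for_small_scale (P := fun e => s (z + e *: (x - z)))) (convex_small cs sz sx).
  by rewrite mulr_ge0 ?divr_ge0 // ltW.
have small2 : for_small (fun e => s (z + (2 * e) *: (v - (a / r) *: l))).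
  apply: (for_small_scale (P := fun e => s (z + e *: (v - (a / r) *: l)))) => //.
  have /(zt.2 _) : linear_part t (v - (a / r) *: l).
    by apply/linear_spaceP => //; rewrite rpredB ?rpredZ.
  by apply: for_small_imp => e _; exact: face_sub.
move: (for_small_and small1 small2); apply: for_small_imp => e _ [s1 s2].
have half : 0 <= (2^-1 : R) <= 1 by rewrite invr_ge0 ler0n invf_le1 ?ler1n.
move: (cs _ _ _ s1 s2 half); congr s; rewrite xE.
apply/rowP => i; rewrite !mxE; field; exact: lt0r_neq0.
Qed.

Section Complex.
Variable X : set (set 'rV[R]_n).
Hypothesis cX : polyhedral_complex X.

Lemma cell_in_facet s : X s -> exists2 t, facet X t & s `<=` t.
Proof.
have /finite_seqP[r XE] := complex_finite cX.
rewrite XE /= => /finite_maximal[t tr [st tmax]].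
by exists t.
Qed.

Lemma relative_interior_cell s z : X s -> s z ->
  exists t, [/\ X t, face t s & relative_interior t z].
Proof.
move=> Xs sz.
have [t [ts tz]] := relative_interior_face_exists (complex_polyhedron cX Xs) sz.
by exists t; split=> //; exact: complex_face ts.
Qed.

Lemma const_on_support c :
  (forall s, X s -> forall x y, s x -> s y -> dot c x = dot c y) ->
  forall x y, complex_support X x -> complex_support X y -> dot c x = dot c y.
Proof.
move=> cell x y [s Xs sx] [t Xt ty].
have [k [f [f0 fk Xf ff]]] := complex_connected cX Xs Xt.
suff path i : (i <= k)%N -> forall w, f i w -> dot c x = dot c w.
  by apply: (path k) => //; rewrite fk.
elim: i => [_ w|i IHi ik w fw]; first by rewrite f0; exact: cell.
have fi := Xf i (ltnW ik); have fi1 := Xf _ ik.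
have [w' [iw' i1w']] : exists w', f i w' /\ f i.+1 w'.
  case: (ff i ik) => /face_sub sub.
    by have [[w' ?] _] := complex_polyhedron cX fi; exists w'; split=> //; exact: sub.
  by exists w; split=> //; exact: sub.
by rewrite (IHi (ltnW ik) _ iw'); exact: cell i1w' fw.
Qed.

End Complex.
End Complexes.

(** * Consequences of balancing *)

Section TropicalVariety.
Variables (R : realType) (n : nat) (X : set (set 'rV[R]_n)).
Variables (w : set 'rV[R]_n -> nat) (d : nat).
Hypotheses (cX : polyhedral_complex X) (pureX : pure_dim X d).
Hypotheses (w_gt0 : forall s, facet X s -> (0 < w s)%N) (balX : balanced X w d).
Implicit Types (s t : set 'rV[R]_n) (c p v x y z : 'rV[R]_n).

Let polyX s : X s -> rational_polyhedron s := @complex_polyhedron _ _ _ cX s.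

Lemma facet_dim s : facet X s -> \dim (linear_space s) = d.
Proof. by move=> /pureX; exact: linear_space_dim. Qed.

Lemma has_dim_linear_space s : X s -> has_dim s (\dim (linear_space s)).
Proof.
move=> /polyX ps; exists (linear_space s); split=> //.
by apply/seteqP; split=> v /(linear_spaceP ps).
Qed.

(** Pairing the balancing condition with [c] gives a vanishing sum. If no term had the sign of [e],
    all terms would vanish and [c] would be constant on [s]. *)
Lemma balanced_opposite_facet s t z c (e : R) :
  facet X s -> X t -> face t s -> relative_interior t z ->
  (\dim (linear_space t)).+1 = d ->
  annihilates c (linear_space t) -> ~ annihilates c (linear_space s) -> e != 0 ->
  exists s' (u : 'rV[int]_n), [/\ facet X s', face t s', lattice_normal t s' u
    & 0 < e * dot c (map_mx intr u)].
Proof.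
move=> fs Xt ts zt dt ct ncs e0.
have /choice[u uP] s1 : exists u, facets_around X t s1 -> lattice_normal t s1 u.
  have [[f1 ts1]|nf] := pselect (facets_around X t s1); last by exists 0.
  have [u ?] := lattice_normal_exists (polyX f1.1) (polyX Xt) ts1 erefl
    (etrans (facet_dim f1) (esym dt)) zt.
  by exists u.
have fin : finite_set (facets_around X t).
  by apply: sub_finite_set (complex_finite cX) => s1 [[]].
have dimt : exists2 k, has_dim t k & d = k.+1.
  by exists (\dim (linear_space t)); rewrite ?dt //; exact: has_dim_linear_space.
have := balX Xt dimt uP; rewrite fsbig_finite //= /lattice /=.
move=> /(linear_spaceP (polyX Xt))/ct.
rewrite raddf_sum dot_sumr => sum0.
apply: contrapT => nex.
have neg s1 : s1 \in fset_set (facets_around X t) ->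
    0 <= - (e * dot c (map_mx intr (u s1 *+ w s1))).
  rewrite in_fset_set // inE => -[f1 ts1].
  rewrite -scaler_nat map_mxZ dotZr mulrCA oppr_ge0 -[_ * _]/(_ * _).
  rewrite rmorph_nat pmulr_rle0 ?ltr0n ?w_gt0 //.
  rewrite leNgt; apply/negP => pos; apply: nex; exists s1, (u s1).
  by split=> //; apply: uP.
have sf : s \in fset_set (facets_around X t) by rewrite in_fset_set // inE.
have sumE : \sum_(s1 <- fset_set (facets_around X t))
    - (e * dot c (map_mx intr (u s1 *+ w s1))) == 0.
  by rewrite sumrN -mulr_sumr sum0 mulr0 oppr0.
have us0 : dot c (map_mx intr (u s)) = 0.
  move: sumE; rewrite big_seq psumr_eq0 // => /allP/(_ s sf).
  rewrite sf /= oppr_eq0 mulf_eq0 (negPf e0) -scaler_nat map_mxZ dotZr mulf_eq0.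
  rewrite rmorph_nat pnatr_eq0 eqn0Ngt w_gt0 //=.
  by move=> /eqP.
apply: ncs; apply: (@const_annihilates _ _ s c (dot c z)) (polyX fs.1) _ => x sx.
have [/(_ _ sx)[y ty [r _ <-]] _] := uP s (conj fs ts).
rewrite dotDr dotZr us0 mulr0 addr0.
apply: (dot_affine_span (s := t)) => // x' tx'.
exact: linear_space_const (polyX Xt) ct _ _ tx' zt.1.
Qed.

(* Walk from a generic point [p] of [s0] in the direction [y - p], modulo [K]. *)
(* At the last point [z] of the walk lying over a facet transverse to [K],     *)
(* genericity of [p] rules out cells of codimension at least two, and          *)
(* balancing at the cell containing [z] gives a facet on which to go on.       *)
Lemma support_meets_transversal s0 (K : {vspace 'rV[R]_n}) y :
  facet X s0 -> (linear_space s0 + K)%VS = fullv ->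
  (linear_space s0 :&: K)%VS = 0%VS ->
  exists2 z, complex_support X z & y - z \in K.
Proof.
move=> fs0 s0K s0I.
have dK : (d + \dim K = n)%N.
  by rewrite -(facet_dim fs0) -(dimv_disjoint_sum s0I) s0K dim_rVfull.
have disjointK s : facet X s -> (linear_space s + K)%VS = fullv ->
    (linear_space s :&: K)%VS = 0%VS.
  move=> fs sK; apply/eqP; rewrite -dimv_eq0; apply/eqP.
  by have := dimv_sum_cap (linear_space s) K; rewrite sK dim_rVfull facet_dim // dK; lia.
apply: contrapT => nex.
have /finite_seqP[r XE] := complex_finite cX.
have rX s : s \in r = `[< X s >] by apply/idP/asboolP; rewrite XE.
pose bad t := ((\dim (linear_space t + K)).+1 < n)%N.
(* For a bad [t], adding one line to [linear_space t + K] cannot fill the space, so [t], its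
   translates along [K] and [y] lie in a common hyperplane. *)
have /choice[c_ c_P] t : exists c, X t -> bad t -> [/\ c != 0,
    annihilates c (linear_space t + K)%VS & forall x, t x -> dot c x = dot c y].
  have [Xt|] := pselect (X t); last by exists 0.
  have [[x tx] _] := polyX Xt.
  case: (boolP (bad t)) => [bt|_]; last by exists 0.
  have dW : (\dim (linear_space t + K + <[y - x]>) < n)%N.
    apply: leq_ltn_trans (dimv_add_leqif _ _).1 (leq_ltn_trans _ bt).
    by rewrite -[leqRHS]addn1 leq_add2l dim_vline; case: (_ != 0).
  have [c c0 cW] := annihilator_exists dW.
  exists c => _ _; split=> // [|x' tx'].
    exact: annihilatesS (addvSl _ _) cW.
  have -> : dot c x' = dot c x.
    apply: (linear_space_const (polyX Xt)) tx' tx.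
    exact: annihilatesS (subv_trans (addvSl _ _) (addvSl _ _)) cW.
  apply/eqP; rewrite eq_sym -subr_eq0 -dotBr cW //.
  by rewrite memvE addvSr.
have [p s0p pgen] : exists2 p, s0 p & forall t, t \in [seq t <- r | bad t] ->
    dot (c_ t) p + - dot (c_ t) y != 0.
  apply: (generic_point (b := fun t => - dot (c_ t) y)).
  - exact: polyhedron_convex (polyX fs0.1).
  - by case: (polyX fs0.1).
  move=> t; rewrite mem_filter rX => /andP[bt /asboolP Xt].
  have [c0 ctK cty] := c_P t Xt bt; apply: contrapT => nx.
  have /eqP := c0; apply; apply: annihilates_full; rewrite -s0K.
  apply: annihilates_add; last exact: annihilatesS (addvSr _ _) ctK.
  apply: (const_annihilates (g := dot (c_ t) y)) (polyX fs0.1) _ => x s0x.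
  apply/eqP; rewrite -subr_eq0; apply/negPn/negP => cx.
  by apply: nx; exists x.
pose v := y - p.
pose good s := facet X s /\ (linear_space s + K)%VS = fullv.
(* The parameters at which the walk lies over the transverse facet [s] modulo [K]. *)
pose A s (e : R) := good s /\ exists2 z, s z & p + e *: v - z \in K.
have Acl s : s \in r -> left_closed (A s).
  rewrite rX => /asboolP Xs T nAT.
  have [gs|ngs] := pselect (good s); last first.
    by exists 1 => // e _ s' [].
  have [[z1 sz1] _] := polyX Xs.
  have decomp x : exists2 l, l \in linear_space s & x - l \in K.
    have := memvf x; rewrite -gs.2 => /memv_addP[l sl [k Kk ->]].
    by exists l; rewrite // addrAC subrr add0r.
  have [l0 sl0 Kl0] := decomp (p - z1); have [l1 sl1 Kl1] := decomp v.
  (* By transversality the walk lifts uniquely along [K] to the affine span of [s]; [A s] is the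
     trace of [s] on the lifted line. *)
  have AE e : A s e <-> s (z1 + l0 + e *: l1).
    split=> [[_ [z sz zK]]|sz]; last first.
      split=> //; exists (z1 + l0 + e *: l1) => //.
      have -> : p + e *: v - (z1 + l0 + e *: l1) = p - z1 - l0 + e *: (v - l1).
        by rewrite scalerBr; apply/rowP => i; rewrite !mxE; ring.
      by rewrite rpredD // rpredZ.
    suff : z1 + l0 + e *: l1 - z \in (linear_space s :&: K)%VS.
      rewrite (disjointK s gs.1 gs.2).
      by rewrite memv0 subr_eq0 => /eqP ->.
    rewrite memv_cap; apply/andP; split.
      have -> : z1 + l0 + e *: l1 - z = (z1 - z) + (l0 + e *: l1).
        by apply/rowP => i; rewrite !mxE; ring.
      apply: rpredD; last by rewrite rpredD ?rpredZ.
      by apply/(linear_spaceP (polyX Xs)); exact: linear_part_sub.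
    have -> : z1 + l0 + e *: l1 - z =
        (p + e *: v - z) - (p - z1 - l0) - e *: (v - l1).
      by rewrite scalerBr; apply/rowP => i; rewrite !mxE; ring.
    by apply: rpredB; [exact: rpredB|exact: rpredZ].
  have [|e e0 eP] := @polyhedron_line_left_closed R n s (z1 + l0) l1 (polyX Xs) T.
    by move/AE.
  by exists e => // e' ee s' /AE; exact: eP ee s'.
have A0 : exists2 s, s \in r & exists2 e, A s e & e <= 1.
  exists s0; first by rewrite rX; apply/asboolP; exact: fs0.1.
  by exists 0; rewrite ?ler01 //; split=> //; exists p; rewrite // scale0r addr0 subrr mem0v.
have [s sr [T [[gs [z sz zK]] T1 Tmax]]] := finite_union_max Acl A0.
have {T1}T1 : T < 1.
  rewrite lt_neqAle T1 andbT; apply/eqP => T1'; apply: nex; exists z.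
    by exists s => //; exact: gs.1.1.
  by move: zK; rewrite T1' scale1r /v [p + _]addrC subrK.
(* Going on beyond [z] in any transverse facet contradicts the maximality of [T]. *)
have advance s' l : good s' -> for_small (fun e => s' (z + e *: l)) ->
    v - l \in K -> False.
  move=> gs' small lK.
  have small1 : for_small (fun e => T + e <= 1).
    by exists (1 - T); [lra|move=> e; lra].
  have := for_small_and small small1 => /for_small_witness[e e0 [s'z e1]].
  suff : T + e <= T by lra.
  apply: (Tmax s') => //; first by rewrite rX; apply/asboolP; exact: gs'.1.1.
  split=> //; exists (z + e *: l) => //.
  have -> : p + (T + e) *: v - (z + e *: l) = p + T *: v - z + e *: (v - l).
    by apply/rowP => i; rewrite !mxE; ring.
  by rewrite rpredD ?rpredZ.
have [t [Xt ts tz]] := relative_interior_cell cX gs.1.1 sz.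
(* If [t] were bad, the hyperplane of [c_ t] would contain [y] and the point of the walk at [T < 1],
   hence also [p], against the choice of [p]. *)
have nbad : (n <= (\dim (linear_space t + K)).+1)%N.
  rewrite leqNgt; apply/negP => bt; have [c0 ctK cty] := c_P t Xt bt.
  have := pgen t; rewrite mem_filter rX asboolT // andbT => /(_ bt)/eqP; apply.
  have : dot (c_ t) (p + T *: v - z) = 0.
    by apply: ctK; apply: (subvP (addvSr _ _)).
  rewrite !(dotBr, dotDr, dotZr) (cty z tz.1) => eq0.
  have : (1 - T) * (dot (c_ t) p - dot (c_ t) y) = 0 by rewrite -eq0; ring.
  by move=> /eqP; rewrite mulf_eq0 => /orP[/eqP|/eqP//]; lra.
(* If the walk moves along [t] modulo [K], it continues in [s]. Otherwise it crosses the hyperplane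
   direction [linear_space t + K], and balancing supplies a facet on the far side. *)
have [/memv_addP[l lt [k Kk vE]]|vtK] := boolP (v \in (linear_space t + K)%VS).
  apply: (advance s l gs); last by rewrite vE addrAC subrr add0r.
  have := tz.2 l ((linear_spaceP (polyX Xt) l).1 lt); apply: for_small_imp => e _.
  exact: face_sub.
have tI : (linear_space t :&: K)%VS = 0%VS.
  apply/eqP; rewrite -subv0 -(disjointK s gs.1 gs.2).
  by apply: capvS => //; exact: linear_spaceS (polyX Xt) (polyX gs.1.1) (face_sub ts).
have tK_lt : (\dim (linear_space t + K) < n)%N.
  by apply: dim_lt_full; apply: contraNneq vtK => ->; rewrite memvf.
have dt : (\dim (linear_space t)).+1 = d.
  by have := dimv_disjoint_sum tI; lia.
have [c c0 ctK] := annihilator_exists tK_lt.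
have ct : annihilates c (linear_space t) := annihilatesS (addvSl _ _) ctK.
have cv : dot c v != 0.
  by apply: contra vtK => /eqP; apply: annihilated_hyperplane ctK.
have ncs : ~ annihilates c (linear_space s).
  move=> cs; move/eqP: c0; apply; apply: annihilates_full; rewrite -gs.2.
  by apply: annihilates_add => //; exact: annihilatesS (addvSr _ _) ctK.
have [s' [u [fs' ts' us' ucv]]] :=
  balanced_opposite_facet gs.1 Xt ts tz dt ct ncs cv.
have cu : dot c (map_mx intr u) != 0.
  by apply: contraTneq ucv => ->; rewrite mulr0 ltxx.
(* With this [a] the vector [v - a u] is killed by [c], hence lies in [linear_space t + K]; [a] is
   nonnegative since [c] has the same sign on [u] and [v]. *)
pose a := dot c v / dot c (map_mx intr u).
have a0 : 0 <= a.
  rewrite /a -[X in _ / X](mulKf cv) invfM invrK mulrA -expr2.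
  by rewrite divr_ge0 ?sqr_ge0 // ltW.
have /memv_addP[l lt [k Kk vE]] :
    v - a *: map_mx intr u \in (linear_space t + K)%VS.
  apply: annihilated_hyperplane nbad c0 ctK _.
  by rewrite dotBr dotZr divfK // subrr.
have dts' : (\dim (linear_space t) < \dim (linear_space s'))%N.
  by rewrite (facet_dim fs') -dt.
apply: (advance s' (l + a *: map_mx intr u)).
- split=> //; apply: full_of_dim; apply: (leq_trans nbad).
  have utK : map_mx intr u \notin (linear_space t + K)%VS.
    by apply: contra cu => /ctK ->.
  apply: leq_trans (addv_line_dim utK) _; apply: dimvS.
  have ts'L := linear_spaceS (polyX Xt) (polyX fs'.1) (face_sub ts').
  rewrite subv_add addvS //= -memvE; apply: (subvP (addvSl _ _)).
  apply/(linear_spaceP (polyX fs'.1)); have [_ latE] := us'.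
  suff : lattice s' u by [].
  rewrite latE; exists 0; last by exists 1; rewrite // add0r.
  by apply/(linear_spaceP (polyX Xt)); rewrite map_mx0 mem0v.
- exact: lattice_normal_direction (polyX fs'.1) (polyX Xt) ts' dts' tz us' lt a0.
by rewrite opprD addrA addrAC vE addrAC subrr add0r.
Qed.

(** A Liouville property. If [c] is not constant on a facet [s0], let [K] be a complement of
    [linear_space s0] inside the kernel of [c]. The support meets every translate of [K], so [c]
    takes the value [M + 1]. *)
Lemma bounded_const_on_support c (M : R) :
  (forall x, complex_support X x -> dot c x <= M) ->
  forall x y, complex_support X x -> complex_support X y -> dot c x = dot c y.
Proof.
move=> cM; apply: const_on_support => // s Xs.
have [s0 fs0 ss0] := cell_in_facet cX Xs.
suff cs0 : annihilates c (linear_space s0).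
  by move=> x y /ss0 sx /ss0 sy; exact: linear_space_const (polyX fs0.1) cs0 _ _ sx sy.
apply: contrapT => ncs0.
have [v0 sv0 cv0] : exists2 v, v \in linear_space s0 & dot c v != 0.
  apply: contrapT => nex; apply: ncs0 => v sv; apply/eqP/negPn/negP => cv.
  by apply: nex; exists v.
pose H := lker (linfun (mulmxr c^T) : 'Hom('rV[R]_n, 'rV[R]_1)).
have HE x : (x \in H) = (dot c x == 0).
  rewrite memv_ker lfunE /=; apply/eqP/eqP => [/rowP/(_ 0)|cx].
    by rewrite !mxE dotC => <-; apply: eq_bigr => i _; rewrite mxE.
  apply/rowP => i; rewrite ord1 !mxE -[RHS]cx dotC.
  by apply: eq_bigr => j _; rewrite mxE.
pose L := linear_space s0; pose K := (H :\: (L :&: H))%VS.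
have KH : (K <= H)%VS := diffvSl _ _.
have LK0 : (L :&: K)%VS = 0%VS.
  apply/eqP; rewrite -subv0; apply/subvP => x; rewrite memv_cap => /andP[xL xK].
  have <- : (K :&: (L :&: H) = 0)%VS by exact: capv_diff.
  by rewrite !memv_cap xK xL (subvP KH).
have LK : (L + K)%VS = fullv.
  apply/vspaceP => x; rewrite memvf.
  pose a := dot c x / dot c v0.
  have : x - a *: v0 \in (K + (L :&: H))%VS.
    rewrite addv_diff; apply: (subvP (addvSl _ _)).
    by rewrite HE dotBr dotZr divfK // subrr.
  move=> /memv_addP[k Kk [l]]; rewrite memv_cap => /andP[lL _] xE.
  rewrite -[x](subrK (a *: v0)) xE -addrA addrC memv_add // rpredD ?rpredZ //.
have [z Xz] := support_meets_transversal (((M + 1) / dot c v0) *: v0) fs0 LK LK0.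
move=> /(subvP KH); rewrite HE dotBr dotZr divfK // subr_eq0 => /eqP zE.
by have := cM z Xz; rewrite -zE; lra.
Qed.

End TropicalVariety.

(** * Finitely generated restriction congruences *)

Section TropicalSums.
Variable R : realType.

Lemma trop_sum_ge (I : eqType) (r : seq I) (F : I -> R) i : i \in r ->
  exists2 a, \sum_(j <- r) Fin (F j) = Fin a & F i <= a.
Proof.
move=> ir; rewrite (big_rem i) //=.
case: (\sum_(j <- rem i r) _) => [|b]; first by exists (F i).
by exists (Num.max (F i) b); rewrite ?le_max ?lexx.
Qed.

Lemma bounded_slope_eq0 (a b : R) : (forall e, a + e * b <= 0) -> b = 0.
Proof.
move=> ab; apply/eqP/negPn/negP => b0.
have := ab ((1 - a) / b); rewrite divfK //; lra.
Qed.

Lemma uniform_nat_bound (I : eqType) (r : seq I) (F : I -> R) :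
  exists k : nat, forall i, i \in r -> F i <= k%:R.
Proof.
elim: r => [|i r [k kP]]; first by exists 0%N.
have [l Fl] : exists l : nat, F i <= l%:R.
  exists (Num.bound `|F i|); apply: le_trans (ler_norm _) _.
  by rewrite ltW // archi_boundP.
exists (k + l)%N => j; rewrite natrD inE => /predU1P[->|/kP jk].
  by apply: le_trans Fl _; rewrite lerDr.
by apply: le_trans jk _; rewrite lerDl.
Qed.

End TropicalSums.

(** * Integer vectors avoiding hyperplanes *)

Section GenericIntegerVector.
Variables (R : realType) (n : nat).

(** If [c] kills the current [t], pass to [N t + v] with [c v] nonzero and [N] so large that the
    earlier products stay nonzero. The second clause says dually that [t] lies in the real span of
    [q]. *)
Lemma generic_integer_combination (q : seq 'rV[int]_n) (C : seq 'rV[R]_n) :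
  (forall c, c \in C -> exists2 v, v \in q & dot c (map_mx intr v) != 0) ->
  exists t : 'rV[int]_n,
    (forall c, c \in C -> dot c (map_mx intr t) != 0) /\
    forall c : 'rV[R]_n, (forall v, v \in q -> dot c (map_mx intr v) = 0) ->
      dot c (map_mx intr t) = 0.
Proof.
elim: C => [_|c C IHC CP].
  by exists 0; split=> // c _; rewrite map_mx0 dot0r.
have [c' c'C|t [Ct tq]] := IHC; first by apply: CP; rewrite inE c'C orbT.
have [v vq cv] := CP c (mem_head _ _).
have [ct|ct] := eqVneq (dot c (map_mx intr t)) 0; last first.
  by exists t; split=> // c'; rewrite inE => /predU1P[->//|/Ct].
have [e e0 eP] : exists2 e, 0 < e & forall c', c' \in C ->
    0 < `|dot c' (map_mx intr t)| + e * - `|dot c' (map_mx intr v)|.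
  have : for_small (fun e => forall c', c' \in C ->
      0 < `|dot c' (map_mx intr t)| + e * - `|dot c' (map_mx intr v)|).
    by apply: for_small_seq => c' /Ct c't; apply: for_small_gt0; rewrite normr_gt0.
  by move=> /for_small_witness.
pose N := Num.bound e^-1.
have eN : e^-1 < N%:R by rewrite archi_boundP // invr_ge0 ltW.
have tvE c' : dot c' (map_mx intr (t *+ N + v)) =
    N%:R * dot c' (map_mx intr t) + dot c' (map_mx intr v).
  by rewrite -scaler_nat map_mxD map_mxZ rmorph_nat dotDr dotZr.
exists (t *+ N + v); split=> [c'|c' c'q]; last by rewrite tvE tq // c'q // mulr0 addr0.
rewrite inE tvE => /predU1P[->|c'C]; first by rewrite ct mulr0 add0r.
have {}eP := eP c' c'C; rewrite addr_eq0; apply/negP => /eqP abs.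
have : `|N%:R * dot c' (map_mx intr t)| = `|dot c' (map_mx intr v)|.
  by rewrite abs normrN.
rewrite normrM ger0_norm // => nE; move: eP; rewrite -nE mulrN mulrA.
rewrite -[X in X - _]mul1r -mulrBl pmulr_lgt0 ?normr_gt0 ?Ct // subr_gt0.
by rewrite ltNge -ler_pdivrMl // mulr1 ltW.
Qed.

End GenericIntegerVector.

(** * Exchanging generators along translates of the support *)

Section Homogeneous.
Variables (R : realType) (n : nat).
Implicit Types (x v z : 'rV[R]_n) (f g h a b : laurent_fun R n).

Lemma monomials_translate (s : seq ('rV[int]_n * R)) x v e :
  (forall m, m \in s -> zdot m.1 v = e) ->
  (\sum_(m <- s) monomial m.1 m.2 : laurent_fun R n) (x + v) =
  (\sum_(m <- s) monomial m.1 m.2 : laurent_fun R n) x * Fin e.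
Proof.
move=> sv; rewrite !fcn_sum mulr_suml; apply: eq_big_seq => m ms /=.
by rewrite zdotDr sv // addrAC.
Qed.

Lemma monomials_ge (s : seq ('rV[int]_n * R)) m x : m \in s ->
  exists2 r, (\sum_(m <- s) monomial m.1 m.2 : laurent_fun R n) x = Fin r
    & zdot m.1 x + m.2 <= r.
Proof. by move=> ms; rewrite fcn_sum /=; exact: trop_sum_ge ms. Qed.

Variables (Z : set 'rV[R]_n) (T z0 : 'rV[R]_n) (k : R) (f : laurent_fun R n).
Hypotheses (Zz0 : Z z0)
  (fT : forall x e, f (x + e *: T) = f x * Fin (- (e * k))).
Hypothesis liouville : forall (u : 'rV[int]_n) (M : R),
  (forall x, Z x -> zdot u x <= M) -> zdot u T = 0.

Lemma homogeneous_context_step (sg : seq ('rV[int]_n * R)) (h a b : laurent_fun R n) :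
  let g : laurent_fun R n := \sum_(m <- sg) monomial m.1 m.2 in
  (forall m m', m \in sg -> m' \in sg -> zdot (m.1 - m'.1) T = 0 ->
     forall x y, Z x -> Z y -> zdot (m.1 - m'.1) x = zdot (m.1 - m'.1) y) ->
  (forall x, Z x -> g x = h x) ->
  f z0 != 0 ->
  (forall x e, Z x -> (a * g + b) (x + e *: T) = f (x + e *: T)) ->
  forall x e, Z x -> (a * h + b) (x + e *: T) = f (x + e *: T).
Proof.
move=> g sgT gh fz0 gf; have [sa aE] := laurent_fun_monomials a.
have [sh hE] := laurent_fun_monomials h.
have [sa0|[ma masa]] : sa = [::] \/ exists m, m \in sa.
    by case: (sa) => [|m s]; [left|right; exists m; exact: mem_head].
  have a0 : a = 0 by rewrite aE sa0 big_nil.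
  by move=> x e Zx; rewrite -gf // a0 !mul0r.
have [sg0|[mg mgsg]] : sg = [::] \/ exists m, m \in sg.
    by case: (sg) => [|m s]; [left|right; exists m; exact: mem_head].
  have g0 : g = 0 by rewrite /g sg0 big_nil.
  suff h0 : h = 0 by move=> x e Zx; rewrite -gf // h0 g0.
  rewrite hE; case: sh hE => [_|m s hE]; first by rewrite big_nil.
  have [r] := monomials_ge z0 (mem_head m s).
  by rewrite -hE -gh // g0.
(* On the line [z0 + R T] the product of the two monomials stays below [f], which is affine of slope
   [- k] there; so it has the same slope. *)
have slope m : m \in sg -> zdot (ma.1 + m.1) T = - k.
  move=> msg; case fz0E : (f z0) fz0 => [/eqP//|r] _.
  apply/eqP; rewrite -addr_eq0; apply/eqP.
  apply: (@bounded_slope_eq0 _ (zdot ma.1 z0 + ma.2 + (zdot m.1 z0 + m.2) - r)) => e.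
  have := gf z0 e Zz0; rewrite fT fz0E /= aE.
  have [a0 -> a0ge] := monomials_ge (z0 + e *: T) masa.
  have [g0 gE g0ge] := monomials_ge (z0 + e *: T) msg.
  rewrite -/g gE.
  have : a0 + g0 <= r - e * k -> zdot ma.1 z0 + ma.2 + (zdot m.1 z0 + m.2) - r +
     e * (zdot (ma.1 + m.1) T + k) <= 0.
    by move: a0ge g0ge; rewrite !zdotDr !zdotZr zdotD; lra.
  move=> imp; case: (b _) => [|b0] [E]; apply: imp; first by rewrite E.
  by rewrite -E le_max lexx.
have {}slope m : m \in sg -> zdot m.1 T = zdot mg.1 T.
  move=> msg; apply: (addrI (zdot ma.1 T)).
  by rewrite -!zdotD !slope.
(* On [Z] the function [g] is one monomial plus a constant, and it bounds each monomial of [h];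
   hence the difference of exponents is bounded above on [Z]. *)
have hslope m : m \in sh -> zdot m.1 T = zdot mg.1 T.
  move=> msh; apply/eqP; rewrite -subr_eq0 -zdotBl; apply/eqP.
  have [r gz0 _] := monomials_ge z0 mgsg.
  apply: (liouville (M := r - zdot mg.1 z0 - m.2)) => x Zx.
  have gx : g x = Fin (r + zdot mg.1 (x - z0)).
    rewrite -[x in LHS](subrK z0) addrC (@monomials_translate _ _ _ (zdot mg.1 (x - z0))).
      by rewrite gz0.
    move=> m' m'sg; apply/eqP; rewrite -subr_eq0 -zdotBl zdotBr subr_eq0; apply/eqP.
    by apply: sgT => //; rewrite zdotBl slope // subrr.
  have [r' hx r'ge] := monomials_ge x msh.
  have : h x = Fin r' by rewrite hE.
  by rewrite -gh // gx => -[]; move: r'ge; rewrite zdotBl zdotBr; lra.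
(* Translation by [e T] adds the same number to [g] and to [h], so their equality on [Z] persists on
   [Z + R T]. *)
move=> x e Zx; rewrite -gf //=; congr (_ * _ + _).
rewrite hE !(@monomials_translate _ _ _ (e * zdot mg.1 T)).
- by rewrite -hE -/g gh.
- by move=> m /slope; rewrite zdotZr => ->.
by move=> m /hslope; rewrite zdotZr => ->.
Qed.

End Homogeneous.

(** * A function that is negative on a narrow cone *)

Section ConeFunction.
Variables (R : realType) (n : nat).
Implicit Types (t : 'rV[int]_n) (x c : 'rV[R]_n).

Definition cone_exponent t (k : nat) (ij : 'I_n * 'I_n) : 'rV[int]_n :=
  k%:Z *: (t 0 ij.1 *: delta_mx 0 ij.2 - t 0 ij.2 *: delta_mx 0 ij.1) - t.

(* The maximum over [i, j] of [k (t_i x_j - t_j x_i) - t . x + b]: it is       *)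
(* negative exactly on a translated cone around the direction [t].             *)
Definition cone_function t (k : nat) (b : R) : laurent_fun R n :=
  \sum_(m <- [seq (cone_exponent t k ij, b) | ij <- enum {: 'I_n * 'I_n}])
    monomial m.1 m.2.

Lemma zdot_cone_exponent t k ij x :
  zdot (cone_exponent t k ij) x =
  k%:R * ((t 0 ij.1)%:~R * x 0 ij.2 - (t 0 ij.2)%:~R * x 0 ij.1) - zdot t x.
Proof.
have zdotZ (a : int) (u : 'rV[int]_n) : zdot (a *: u) x = a%:~R * zdot u x.
  by rewrite mulr_sumr; apply: eq_bigr => l _; rewrite mxE rmorphM mulrA.
have zdot_delta l : zdot (delta_mx 0 l) x = x 0 l.
  rewrite /zdot (bigD1 l) //= !mxE !eqxx mul1r big1 ?addr0 // => l' l'l.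
  by rewrite mxE (negPf l'l) andbF mul0r.
by rewrite zdotBl zdotZ zdotBl !zdotZ !zdot_delta.
Qed.

Lemma cone_function_translate t k b x e :
  let T := map_mx intr t in
  cone_function t k b (x + e *: T) =
  cone_function t k b x * Fin (- (e * dot T T)).
Proof.
move=> T; apply: monomials_translate => _ /mapP[ij _ ->] /=.
rewrite zdot_cone_exponent zdotZr zdot_dot !mxE; ring.
Qed.

(** The index [i] witnesses that [n] is positive; for [n = 0] the maximum is empty and equals
    -oo. *)
Lemma cone_function_finite t k b x (i : 'I_n) : cone_function t k b x != 0.
Proof.
have m_in : (cone_exponent t k (i, i), b) \in
    [seq (cone_exponent t k ij, b) | ij <- enum {: 'I_n * 'I_n}].
  by apply/mapP; exists (i, i); rewrite ?mem_enum.
by have [r -> _] := monomials_ge x m_in.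
Qed.

Lemma cone_function_ge0 t k b x ij :
  0 <= zdot (cone_exponent t k ij) x + b ->
  cone_function t k b x + 1 = cone_function t k b x.
Proof.
move=> ge0; have m_in : (cone_exponent t k ij, b) \in
    [seq (cone_exponent t k ij, b) | ij <- enum {: 'I_n * 'I_n}].
  by apply/mapP; exists ij; rewrite ?mem_enum.
have [r -> rge] := monomials_ge x m_in.
by congr Fin; apply/max_idPl; exact: le_trans ge0 rge.
Qed.

(* [sum_j c_j (t_i x_j - t_j x_i) = t_i g - x_i] bounds [x_i] on the affine    *)
(* hyperplane [c . x = g] by the numbers [t_i x_j - t_j x_i].                  *)
Lemma cone_function_bound t c (g : R) :
  dot c (map_mx intr t) = 1 -> exists C : R, forall (k : nat) (b : R) x,
    C <= k%:R -> C <= b -> dot c x = g ->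
    exists ij, 0 <= zdot (cone_exponent t k ij) x + b.
Proof.
move=> ct; set T := map_mx intr t in ct.
pose B := \sum_i `|T 0 i| * `|T 0 i * g|.
pose D := \sum_i `|T 0 i| * \sum_j `|c 0 j|.
have D0 : 0 <= D by apply: sumr_ge0 => i _; rewrite mulr_ge0 // sumr_ge0.
have B0 : 0 <= B by apply: sumr_ge0 => i _; rewrite mulr_ge0.
(* The bound [k >= D] absorbs the error [D * (W / k)] into [W]; then [T . x <= B + T . x - b]
   contradicts [b > B]. *)
exists (B + D + 1) => k b x Ck Cb cx; apply: contrapT => nex.
have k0 : 0 < k%:R :> R by lra.
pose W := dot T x - b.
have TE i : T 0 i = (t 0 i)%:~R by rewrite mxE.
have DW i j : k%:R * (T 0 i * x 0 j - T 0 j * x 0 i) < W.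
  rewrite ltNge; apply/negP => Wle; apply: nex; exists (i, j).
  by rewrite zdot_cone_exponent zdot_dot -/T /= -!TE; move: Wle; rewrite /W; lra.
have DWk i j : `|T 0 i * x 0 j - T 0 j * x 0 i| <= W / k%:R.
  rewrite ler_norml ler_pdivlMr // lerNl ler_pdivlMr //.
  by have := DW i j; have := DW j i; lra.
have xi i : `|x 0 i| <= `|T 0 i * g| + \sum_j `|c 0 j| * (W / k%:R).
  have -> : x 0 i = T 0 i * g - \sum_j c 0 j * (T 0 i * x 0 j - T 0 j * x 0 i).
    under eq_bigr do rewrite mulrBr [X in _ - X]mulrA [X in X - _]mulrCA.
    rewrite sumrB -mulr_sumr -mulr_suml -/(dot c x) cx -/(dot c T) ct; ring.
  apply: le_trans (ler_normB _ _) _; rewrite lerD2l.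
  apply: le_trans (ler_norm_sum _ _ _) _; apply: ler_sum => j _.
  by rewrite normrM ler_wpM2l.
have Tx : dot T x <= B + D * (W / k%:R).
  apply: le_trans (ler_norm _) _; apply: le_trans (ler_norm_sum _ _ _) _.
  rewrite /B /D mulr_suml -big_split /=; apply: ler_sum => i _.
  rewrite normrM -mulrA -mulrDr ler_wpM2l // mulr_suml; exact: xi.
have [i0 _] : exists i : 'I_n, true.
  case: (pickP 'I_n) => [i _|no]; first by exists i.
  by move: ct; rewrite /dot big1 => [/esym/eqP|i]; [rewrite oner_eq0|have := no i].
have W0 : 0 < W by have := DW i0 i0; rewrite subrr mulr0.
have : D * (W / k%:R) <= W.
  rewrite mulrA ler_pdivrMr // mulrC ler_wpM2l ?(ltW W0) //; lra.
by move: Tx; rewrite /W; lra.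
Qed.

End ConeFunction.

(** * From finite generation to an affine subspace *)

Section Main.
Variables (R : realType) (n : nat) (X : set (set 'rV[R]_n)).
Variables (w : set 'rV[R]_n -> nat) (d : nat).
Hypotheses (cX : polyhedral_complex X) (pureX : pure_dim X d).
Hypotheses (w_gt0 : forall s, facet X s -> (0 < w s)%N) (balX : balanced X w d).

Let Z := complex_support X.
Let polyX s : X s -> rational_polyhedron s := @complex_polyhedron _ _ _ cX s.

Lemma support_nonempty : exists z, Z z.
Proof.
have [s Xs] := complex_nonempty cX; have [[z sz] _] := polyX Xs.
by exists z, s.
Qed.

(** Integer generators of the directions of all cells together. They enter only through the forms
    that kill them, which by connectedness are the forms constant on [Z]. *)
Lemma direction_vectors : exists q : seq 'rV[int]_n,
  (forall c, (forall v, v \in q -> dot c (map_mx intr v) = 0) ->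
    forall x y, Z x -> Z y -> dot c x = dot c y) /\
  (forall c, (forall x y, Z x -> Z y -> dot c x = dot c y) ->
    forall v, v \in q -> dot c (map_mx intr v) = 0).
Proof.
have /finite_seqP[r XE] := complex_finite cX.
have /choice[Q QP] s : exists q : seq 'rV[int]_n, X s ->
    linear_space s = <<[seq map_mx intr u | u <- q]>>%VS.
  have [/polyX/linear_space_span[q qE]|] := pselect (X s); first by exists q.
  by exists [::].
exists (flatten [seq Q s | s <- r]); split=> c cP.
  apply: const_on_support => // s Xs; apply: linear_space_const (polyX Xs) _.
  rewrite QP //; apply: annihilates_span => _ /mapP[v vQ ->]; apply: cP.
  by apply/flatten_mapP; exists s => //; move: Xs; rewrite XE.
move=> v /flatten_mapP[s sr vQ]; have Xs : X s by rewrite XE.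
have [[x0 sx0] _] := polyX Xs.
have cs : annihilates c (linear_space s).
  apply: (const_annihilates (g := dot c x0)) (polyX Xs) _ => x sx.
  by apply: cP; exists s.
by apply: cs; rewrite QP // memv_span // map_f.
Qed.

(** For [z] in the affine span of [s] and a complement [K] of the direction, the support has a point
    [z'] with [z - z'] in [K]. It lies in the same affine span, so [z = z']. *)
Lemma support_affine_of_facet s : facet X s ->
  (forall c, annihilates c (linear_space s) ->
     forall x y, Z x -> Z y -> dot c x = dot c y) ->
  rational_affine_subspace Z.
Proof.
move=> fs sZ; have ps := polyX fs.1; have [[z0 sz0] _] := ps.
have [q qE] := linear_space_span ps.
have Zz0 : Z z0 by exists s => //; exact: fs.1.
exists z0, (size q), (tnth (in_tuple q)).
have spanE v : v \in linear_space s <->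
    exists c : 'I_(size q) -> R, v = \sum_i c i *: map_mx intr (tnth (in_tuple q) i).
  split=> [|[c ->]]; last first.
    by apply: memv_suml => i _; rewrite memvZ // qE memv_span // map_f ?mem_tnth.
  rewrite qE span_def big_map big_tnth => /memv_sumP[vs vsP ->].
  have /choice[c cP] i : exists a, vs i = a *: map_mx intr (tnth (in_tuple q) i).
    by have /vlineP := vsP i isT.
  by exists c; apply: eq_bigr => i _.
have ZE z : Z z <-> z - z0 \in linear_space s.
  split=> [Zz|zs].
    apply: contraT => /separating_functional[c cs].
    by rewrite dotBr (sZ c cs z z0) // subrr => /eqP; rewrite eq_sym oner_eq0.
  pose K := ((linear_space s)^C)%VS.
  have [z' Zz' zK] := support_meets_transversal cX pureX w_gt0 balX z fs
    (addv_complf _) (capv_compl _).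
  have : z - z' \in (linear_space s :&: K)%VS.
    rewrite memv_cap zK andbT -[z](subrK z0) -addrA rpredD //.
    rewrite -opprB rpredN; apply: contraT => /separating_functional[c cs].
    by rewrite dotBr (sZ c cs z' z0) // subrr => /eqP; rewrite eq_sym oner_eq0.
  by rewrite capv_compl memv0 subr_eq0 => /eqP ->.
apply/seteqP; split=> [z /ZE/spanE[c cE]|_ [c _ <-]].
  by exists c; rewrite // -cE addrC subrK.
by apply/ZE/spanE; exists c; rewrite addrAC subrr add0r.
Qed.

Lemma finitely_generated_restriction_affine_support :
  finitely_generated_congruence (restriction_congruence Z) ->
  rational_affine_subspace Z.
Proof.
move=> [A [/finite_seqP[rA AE] EA]].
have [q [qZ Zq]] := direction_vectors.
(* If one facet direction contains all cell directions, the support is affine. Otherwise each facet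
   misses some vector of [q]. *)
have [[s fs sq]|nofacet] := pselect (exists2 s, facet X s &
    forall v, v \in q -> map_mx intr v \in linear_space s).
  apply: (support_affine_of_facet fs) => c cs; apply: qZ => v /sq.
  exact: cs.
have /finite_seqP[r XE] := complex_finite cX.
have cs_ex s : exists c, facet X s -> annihilates c (linear_space s) /\
    exists2 v, v \in q & dot c (map_mx intr v) != 0.
  have [fs|] := pselect (facet X s); last by exists 0.
  have [v vq vs] : exists2 v, v \in q & map_mx intr v \notin linear_space s.
    apply: contrapT => nex; apply: nofacet; exists s => // v vq.
    by apply/negPn/negP => vs; apply: nex; exists v.
  have [c cs cv] := separating_functional vs.
  by exists c => _; split=> //; exists v; rewrite // cv oner_eq0.
have {cs_ex}[cs csP] := choice cs_ex.
have [rep repP] := choice (@laurent_fun_monomials R n).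
pose differences (g : laurent_fun R n) :=
  [seq m.1 - m'.1 | m <- rep g, m' <- rep g].
pose F := flatten [seq differences fg.1 ++ differences fg.2 | fg <- rA].
(* The vector [t] must pair nontrivially with one annihilator of each facet, hence lies in no facet
   direction, and with every exponent difference that is not constant on [Z]. *)
have [|t [Ct tq]] := @generic_integer_combination R n q
    ([seq cs s | s <- r & `[< facet X s >]] ++ [seq map_mx intr u | u <- F
      & has (fun v => dot (map_mx intr u) (map_mx intr v : 'rV[R]_n) != 0) q]).
  move=> c; rewrite mem_cat => /orP[] /mapP[s]; rewrite mem_filter.
    by move=> /andP[/asboolP/csP[_ ?] _] ->.
  by move=> /andP[/hasP ?] _ ->.
set T := map_mx intr t in Ct tq.
have constT c : (forall x y, Z x -> Z y -> dot c x = dot c y) -> dot c T = 0.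
  by move=> /Zq; exact: tq.
have FT u : u \in F -> zdot u T = 0 -> forall x y, Z x -> Z y -> zdot u x = zdot u y.
  move=> uF uT x y Zx Zy; rewrite !zdot_dot; apply: qZ Zx Zy => v vq.
  apply/eqP; apply: contraT => uv; move: uT; rewrite zdot_dot => /eqP; apply: contraLR => _.
  apply: Ct; rewrite mem_cat; apply/orP; right; apply: map_f.
  by rewrite mem_filter uF andbT; apply/hasP; exists v.
have liouville (u : 'rV[int]_n) (M : R) : (forall x, Z x -> zdot u x <= M) -> zdot u T = 0.
  move=> uM; rewrite zdot_dot; apply: constT.
  apply: (bounded_const_on_support cX pureX w_gt0 balX) => x Zx.
  by rewrite -zdot_dot; exact: uM.
have facetT s : facet X s -> exists2 c, annihilates c (linear_space s) & dot c T = 1.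
  move=> fs; have sT : dot (cs s) T != 0.
    apply: Ct; rewrite mem_cat map_f // mem_filter asboolT //=.
    by have := fs.1; rewrite {1}XE.
  exists ((dot (cs s) T)^-1 *: cs s); last by rewrite dotZl mulVf.
  by move=> v vs; rewrite dotZl ((csP s fs).1 v vs) mulr0.
have bound_ex s : exists C : R, facet X s -> forall (k : nat) (b : R) x,
    C <= k%:R -> C <= b -> s x -> exists ij, 0 <= zdot (cone_exponent t k ij) x + b.
  have [fs|] := pselect (facet X s); last by exists 0.
  have [c cs1 cT] := facetT s fs; have [[x0 sx0] _] := polyX fs.1.
  have [C CP] := cone_function_bound (dot c x0) cT.
  exists C => _ k b x Ck Cb sx; apply: CP => //.
  exact: linear_space_const (polyX fs.1) cs1 _ _ sx sx0.
have {bound_ex}[C CP] := choice bound_ex.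
have [k kP] := uniform_nat_bound r C.
(* One [k] beyond all facet bounds serves as slope and as offset, so the negative cone of [f] misses
   [Z]. *)
pose f : laurent_fun R n := cone_function t k k%:R.
have f_ge0 x : Z x -> f x + 1 = f x.
  move=> [s Xs sx]; have [s' fs' ss'] := cell_in_facet cX Xs.
  have kC : C s' <= k%:R by apply: kP; have := fs'.1; rewrite {1}XE.
  have [ij] := CP s' fs' k _ x kC kC (ss' _ sx); exact: cone_function_ge0.
have [z0 Zz0] := support_nonempty.
have [i Ti] : exists i, T 0 i != 0.
  have [s0 Xs0 _] := Zz0; have [s' fs' _] := cell_in_facet cX Xs0.
  have [c _ cT] := facetT s' fs'; apply: contrapT => nex.
  move: cT; rewrite /dot big1 => [/esym/eqP|i _]; first by rewrite oner_eq0.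
  by have [->|Ti] := eqVneq (T 0 i) 0; [rewrite mulr0|case: nex; exists i].
have TT : 0 < dot T T.
  rewrite /dot (bigD1 i) //= ltr_pwDl ?sumr_ge0 //.
    by rewrite -expr2 exprn_even_gt0.
  by move=> j _; rewrite -expr2 sqr_ge0.
have fT x e : f (x + e *: T) = f x * Fin (- (e * dot T T)).
  exact: cone_function_translate.
have fz0 : f z0 != 0 by exact: cone_function_finite.
(* This holds for [f], and it passes to everything congruent to [f] once generators preserve it in
   contexts. *)
pose P (h : laurent_fun R n) := forall x e, Z x -> h (x + e *: T) = f (x + e *: T).
have AP : A `<=` syntactic_congruence P.
  have step (g h a b : laurent_fun R n) :
      (forall m m', m \in rep g -> m' \in rep g -> m.1 - m'.1 \in F) ->
      (forall x, Z x -> g x = h x) -> P (a * g + b) -> P (a * h + b).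
    move=> gF gh; rewrite /P {1}(repP g).
    apply: (homogeneous_context_step Zz0 fT liouville) => //.
      by move=> m m' mg m'g; apply: FT; exact: gF.
    by move=> x Zx; rewrite -repP gh.
  move=> [g h] Agh a b /=; have ghA : (g, h) \in rA by move: Agh; rewrite AE.
  have gh : restriction_congruence Z (g, h) by rewrite EA => D [_]; apply.
  have inF g' u : g' = g \/ g' = h -> u \in differences g' -> u \in F.
    move=> gE ug; apply/flatten_mapP; exists (g, h) => //=.
    by rewrite mem_cat; case: gE => <-; rewrite ug ?orbT.
  split; apply: step => [m m' mg m'g|x Zx].
  - by apply: (inF g); [left|apply/allpairsP; exists (m, m')].
  - exact: gh.
  - by apply: (inF h); [right|apply/allpairsP; exists (m, m')].
  by rewrite gh.
have ff1 : restriction_congruence Z (f, f + 1).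
  by move=> x Zx; rewrite /= -[RHS]/(f x + 1) f_ge0.
have : syntactic_congruence P (f, f + 1).
  by move: ff1; rewrite EA; apply; split=> //; exact: congruence_syntactic.
move=> /(_ 1 0)[/(_ _)] /=; rewrite !mul1r !addr0 => Pf _.
have {Pf} Pf1 : P (f + 1) by apply: Pf.
case fz0E : (f z0) fz0 => [/eqP//|b] _.
(* At this parameter [f] has the negative value [b - (|b| + 1)], while the maximum [f + 1] is at
   least the real number 0. *)
have := Pf1 z0 ((`|b| + 1) / dot T T) Zz0.
rewrite -[LHS]/(f _ + 1) fT fz0E divfK ?gt_eqF // => -[E].
have : (0 : R) <= b + - (`|b| + 1) by rewrite -E le_max lexx orbT.
by have := ler_norm b; lra.
Qed.

End Main.

Theorem theorem1p1 (R : realType) (n : nat) (X : tropical_variety R n) :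
  finitely_generated_congruence (restriction_congruence (complex_support X)) <->
  rational_affine_subspace (complex_support X).
Proof.
split; last exact: finitely_generated_restriction_affine.
exact: (finitely_generated_restriction_affine_support (tv_complex X)
  (@tv_pure _ _ X) (@tv_weight_gt0 _ _ X) (@tv_balanced _ _ X)).
Qed.
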